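(* Let $X$ be an infinite-dimensional complex Banach space, $T\in L(X)$, $\lambda_0\in\mathbb C$, and suppose that $\lambda_0-T$ admits a generalized Kato-meromorphic decomposition. Then the following statements are equivalent: (i) $T$ has the SVEP at $\lambda_0$; (ii) $\lambda_0$ is not an interior point of $\sigma_{ap}(T)$; (iii) $\sigma_{B\mathcal B_+}(T)$ does not cluster at $\lambda_0$ (that is, $\lambda_0$ is not an accumulation point of $\sigma_{B\mathcal B_+}(T)$).
   Context: $L(X)$ is the algebra of bounded linear operators on $X$; $N(T)$, $R(T)$ are kernel and range; $\sigma_{ap}(T)=\{\lambda\in\mathbb C:T-\lambda I\text{ is not bounded below}\}$. $(M,N)\in Red(T)$ means that $M,N$ are closed $T$-invariant subspaces with $X=M\oplus N$; $T_M$, $T_N$ are the restrictions of $T$ viewed as operators on $M$, $N$. $T$ is Kato if $R(T)$ is closed and $N(T)\subset R(T^n)$ for every $n\in\mathbb N$. An operator is meromorphic if every non-zero point of its spectrum is a pole of its resolvent. An operator $T$ admits a generalized Kato-meromorphic decomposition if there is $(M,N)\in Red(T)$ with $T_M$ Kato and $T_N$ meromorphic. $T$ is upper semi-Browder if it is upper semi-Fredholm (finite-dimensional kernel and closed range) with finite ascent. $T$ is upper semi-B-Browder if there is an integer $n\ge0$ such that $R(T^n)$ is closed and the restriction of $T$ to $R(T^n)$, viewed as a map $R(T^n)\to R(T^n)$, is upper semi-Browder; it is known that this is equivalent to left Drazin invertibility: the ascent $a(T)$ is finite and $R(T^{a(T)+1})$ is closed. $\sigma_{B\mathcal B_+}(T)=\{\lambda\in\mathbb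 C:T-\lambda I\text{ is not upper semi-B-Browder}\}$. $T$ has the SVEP (single-valued extension property) at $\lambda_0$ if for every open disc $\mathcal D_{\lambda_0}$ centered at $\lambda_0$ the only analytic function $f:\mathcal D_{\lambda_0}\to X$ satisfying $(T-\lambda)f(\lambda)=0$ for all $\lambda\in\mathcal D_{\lambda_0}$ is $f\equiv 0$. *)

(* Defs.v *)
From mathcomp Require Import all_boot all_order all_algebra.
From mathcomp Require Import complex.
From mathcomp Require Import all_classical all_reals.
From mathcomp Require Import topology normedtype sequences.

Set Implicit Arguments.
Unset Strict Implicit.
Unset Printing Implicit Defensive.

Import Order.TTheory GRing.Theory Num.Theory.
Import numFieldNormedType.Exports.

Local Open Scope classical_set_scope.
Local Open Scope ring_scope.

(* The field R[i], typed by its structure so that the topology, norm and module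
   structures of numFieldNormedType apply to it. Real quantities (norms, radii,
   constants) live in R[i] too: 0 < r in R[i] forces r to be real. *)
Definition Cplx (R : realType) : numClosedFieldType := R[i].

Section Operators.
Context {R : realType} {X : completeNormedModType (Cplx R)}.
Local Notation C := (Cplx R).
Implicit Types (A B : X -> X) (M N K : set X) (z mu : C).

Definition is_subspace M : Prop :=
  M 0 /\ forall (a : C) (x y : X), M x -> M y -> M (a *: x + y).

Definition closed_subspace M : Prop := is_subspace M /\ closed M.

Definition finite_dim K : Prop :=
  exists (n : nat) (e : 'I_n -> X),
    (forall i, K (e i)) /\
    (forall x, K x -> exists c : 'I_n -> C, x = \sum_(i < n) c i *: e i).

(* An operator on a subspace M is represented by a map X -> X that sends M to M,
   of which only the values on M are relevant. Hence the pair (A, M) with A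
   leaving M invariant stands for the restriction of A viewed as an operator
   on M. The subspaces M used below are closed, so that a subset of M is closed
   in M iff it is closed in X. *)
Definition ker A M : set X := [set x | M x /\ A x = 0].
Definition ran A M : set X := A @` M.

(* B is an element of L(M) *)
Definition bounded_operator_on M B : Prop :=
  [/\ forall x, M x -> M (B x),
      forall (a : C) (x y : X),
        M x -> M y -> B (a *: x + y) = a *: B x + B y
    & exists c : C, forall x, M x -> `|B x| <= c * `|x| ].

(* convergence in the operator norm of L(M) *)
Definition cvg_operator_norm M (S : nat -> X -> X) B : Prop :=
  forall eps : C, 0 < eps ->
    \forall n \near \oo, forall x, M x -> `|S n x - B x| <= eps * `|x|.

Definition bounded_below A : Prop :=
  exists c : C, 0 < c /\ forall x, c * `|x| <= `|A x|.

(* B = (z I - A)^-1 in L(M) *)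
Definition is_resolvent A M z B : Prop :=
  [/\ bounded_operator_on M B,
      forall x, M x -> z *: B x - A (B x) = x
    & forall x, M x -> B (z *: x - A x) = x].

Definition spectrum A M : set C :=
  [set z | ~ exists B, is_resolvent A M z B].

(* mu is a pole of order n.+1 of the resolvent of A: on a punctured disc about
   mu the resolvent has a Laurent expansion
     \sum_(k >= 0) (z - mu) ^ (k - n.+1) P_k   with P_0 != 0,
   converging in the norm of L(M). In particular mu is isolated in the
   spectrum. *)
Definition is_resolvent_pole A M mu : Prop :=
  exists (n : nat) (r : C) (P : nat -> X -> X),
    [/\ 0 < r,
        forall k, bounded_operator_on M (P k),
        exists x, M x /\ P 0%N x <> 0
      & forall z, ball mu r z -> z <> mu ->
          exists B, is_resolvent A M z B /\
            cvg_operator_norm M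
              (fun m x => \sum_(0 <= k < m)
                 ((z - mu) ^+ k / (z - mu) ^+ n.+1) *: P k x) B].

Definition meromorphic A M : Prop :=
  forall mu, spectrum A M mu -> mu <> 0 -> is_resolvent_pole A M mu.

Definition Kato A M : Prop :=
  closed (ran A M) /\ forall n : nat, ker A M `<=` ran (iter n A) M.

Definition Red A M N : Prop :=
  [/\ closed_subspace M /\ closed_subspace N,
      forall x, M x -> M (A x),
      forall x, N x -> N (A x),
      forall x, exists u v, [/\ M u, N v & x = u + v]
    & M `&` N = [set 0]].

Definition generalized_Kato_meromorphic A : Prop :=
  exists M N, [/\ Red A M N, Kato A M & meromorphic A N].

Definition upper_semi_Fredholm A M : Prop :=
  finite_dim (ker A M) /\ closed (ran A M).

Definition finite_ascent A M : Prop :=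
  exists p : nat, ker (iter p A) M = ker (iter p.+1 A) M.

Definition upper_semi_Browder A M : Prop :=
  upper_semi_Fredholm A M /\ finite_ascent A M.

Definition upper_semi_B_Browder A : Prop :=
  exists n : nat, closed (ran (iter n A) setT) /\
    upper_semi_Browder A (ran (iter n A) setT).

Definition sub_scalar A z : X -> X := fun x => A x - z *: x.
Definition scalar_sub z A : X -> X := fun x => z *: x - A x.

Definition sigma_ap A : set C := [set z | ~ bounded_below (sub_scalar A z)].

Definition sigma_BBplus A : set C :=
  [set z | ~ upper_semi_B_Browder (sub_scalar A z)].

(* f is locally the sum of a convergent power series with coefficients in X;
   for open D only the values of f on D matter. *)
Definition analytic_on (D : set C) (f : C -> X) : Prop :=
  forall a, D a -> exists (s : C) (c : nat -> X), 0 < s /\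
    forall z, ball a s z -> series (fun k => (z - a) ^+ k *: c k) @ \oo --> f z.

Definition SVEP A z0 : Prop :=
  forall r : C, 0 < r -> forall f : C -> X,
    analytic_on (ball z0 r) f ->
    (forall z, ball z0 r z -> sub_scalar A z (f z) = 0) ->
    forall z, ball z0 r z -> f z = 0.

End Operators.

(* Main.v *)
(* Write A = T - lambda0, X = M (+) N with A Kato on M and lambda0 - T
   meromorphic on N.

   SVEP at lambda0 makes A injective on M: by the open mapping theorem a vector
   x_0 of the kernel of A in M has a backward orbit A x_(k+1) = x_k that grows at
   most geometrically, and f(lambda0 + w) = \sum_k w^k x_k solves
   (T - lambda) f(lambda) = 0 with f(lambda0) = x_0. Hence T - lambda is bounded
   below on M for lambda near lambda0. For lambda <> lambda0 the regular part of
   the Laurent expansion of the resolvent on N gives an operator D commuting with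
   B = T - lambda such that B^(q+1) D = B^q on N (with q = 0 in the resolvent
   set, which accumulates at lambda0). These two facts give that T - lambda is
   bounded below for some lambda arbitrarily close to lambda0, and upper
   semi-B-Browder for all lambda <> lambda0 close to lambda0.

   Conversely, if B = T - lambda has a closed ran (B^n) on which its ascent is
   finite, then the power series at lambda of a solution of (T - z) f(z) = 0
   vanishes: its coefficients form a backward orbit of B in ran (B^n) starting in
   ker B. The identity theorem extends f = 0 to the whole disc. *)

Require Import Defs.
From mathcomp Require Import all_boot all_order all_algebra.
From mathcomp Require Import complex.
From mathcomp Require Import all_classical all_reals.
From mathcomp Require Import topology normedtype sequences.
From mathcomp Require Import lra ring.
Import Order.TTheory GRing.Theory Num.Theory.
Import numFieldNormedType.Exports.
Local Open Scope classical_set_scope.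
Local Open Scope ring_scope.

Set Implicit Arguments.
Unset Strict Implicit.
Unset Printing Implicit Defensive.

(** * The norm with values in R *)

Section RealNorm.
Context {R : realType}.
Local Notation C := (Cplx R).

Definition rc (r : R) : C := real_complex R r.

Lemma rc_ge0 r : (0 <= rc r) = (0 <= r).
Proof. exact: ler0c. Qed.

Lemma rc_lt r s : (rc r < rc s) = (r < s).
Proof. exact: ltcR. Qed.

Lemma rc_gt0 r : (0 < rc r) = (0 < r).
Proof. exact: (ltcR 0 r). Qed.

Lemma rc_le r s : (rc r <= rc s) = (r <= s).
Proof. exact: lecR. Qed.

Lemma rcM r s : rc (r * s) = rc r * rc s.
Proof. exact: rmorphM. Qed.

Lemma rcD r s : rc (r + s) = rc r + rc s.
Proof. exact: rmorphD. Qed.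

Lemma gt0_rc (z : C) : 0 < z -> exists2 r : R, 0 < r & z = rc r.
Proof.
move=> z0; have /complex_realP[r zr] : z \is Num.real by exact: gtr0_real.
by exists r => //; rewrite -rc_gt0 /rc -zr.
Qed.

Section Norm.
Context {U : normedModType C}.
Implicit Types (x y z : U) (a : C).

(* The norm of U takes its values in R[i], whose order is only partial. *)
Definition rn x : R := complex.Re `|x|.

Lemma rnE x : `|x| = rc (rn x).
Proof. by rewrite /rc /rn RRe_real // normr_real. Qed.

Lemma rn_ge0 x : 0 <= rn x.
Proof. by rewrite -rc_ge0 -rnE. Qed.

Lemma rnD x y : rn (x + y) <= rn x + rn y.
Proof. by rewrite -rc_le rcD -!rnE ler_normD. Qed.

Lemma rnN x : rn (- x) = rn x.
Proof. by rewrite /rn normrN. Qed.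

Lemma rnB x y : rn (x - y) <= rn x + rn y.
Proof. by rewrite -(rnN y) rnD. Qed.

Lemma rnC x y : rn (x - y) = rn (y - x).
Proof. by rewrite -rnN opprB. Qed.

Lemma rn_triangle z x y : rn (x - y) <= rn (x - z) + rn (z - y).
Proof. by rewrite -(subrKA z); exact: rnD. Qed.

Lemma rn_sub x y : rn x <= rn (x - y) + rn y.
Proof. by rewrite -{1}(subrK y x) rnD. Qed.

Lemma rn0 : rn (0 : U) = 0.
Proof. by rewrite /rn normr0. Qed.

Lemma rn_eq0 x : rn x = 0 -> x = 0.
Proof. by move=> x0; apply: normr0_eq0; rewrite rnE x0. Qed.

Lemma rn_gt0 x : x <> 0 -> 0 < rn x.
Proof.
move=> x0; rewrite lt0r rn_ge0 andbT; apply/eqP => /rn_eq0; exact: x0.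
Qed.

Lemma rn_small x : (forall e : R, 0 < e -> rn x < e) -> x = 0.
Proof.
move=> h; apply: contrapT => /rn_gt0 /h; by rewrite ltxx.
Qed.

Lemma rn_sum (I : Type) (s : seq I) (F : I -> U) :
  rn (\sum_(i <- s) F i) <= \sum_(i <- s) rn (F i).
Proof.
elim/big_rec2: _ => [|i r x _ le_xr]; first by rewrite rn0.
by apply: le_trans (rnD _ _) _; rewrite lerD2l.
Qed.

End Norm.

Lemma rnM (a b : C) : rn (a * b) = rn a * rn b.
Proof. by apply: complexI; rewrite -!/(rc _) rcM -!rnE normrM. Qed.

Lemma rn1 : rn (1 : C) = 1.
Proof. by rewrite /rn normr1. Qed.

Lemma rnX (a : C) n : rn (a ^+ n) = rn a ^+ n.
Proof. by elim: n => [|n ih]; rewrite ?expr0 ?rn1 // !exprS rnM ih. Qed.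

Lemma rn_rc (r : R) : 0 <= r -> rn (rc r) = r.
Proof. by move=> r0; rewrite /rn ger0_norm // rc_ge0. Qed.

Lemma rnZ (U : normedModType C) (a : C) (x : U) : rn (a *: x) = rn a * rn x.
Proof. by apply: complexI; rewrite -!/(rc _) rcM -!rnE normrZ. Qed.

Lemma rnV (a : C) : rn a^-1 = (rn a)^-1.
Proof.
have [->|a0] := eqVneq a 0; first by rewrite invr0 rn0 invr0.
have ra : rn a != 0 by apply/eqP => /rn_eq0/eqP; rewrite (negbTE a0).
by apply: (mulfI ra); rewrite -rnM !divff // rn1.
Qed.

Lemma ball_rnP (U : normedModType C) (x y : U) (r : R) :
  ball x (rc r) y <-> rn (x - y) < r.
Proof. by rewrite -ball_normE /= /ball_ /= rnE rc_lt. Qed.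

Lemma nbhs_rnP (U : normedModType C) (x : U) (P : set U) :
  nbhs x P <-> exists2 r : R, 0 < r & forall y, rn (y - x) < r -> P y.
Proof.
rewrite nbhs_ballP; split=> [[z /= /gt0_rc[r r0 ->] h]|[r r0 h]].
  by exists r => // y; rewrite rnC => /ball_rnP/h.
by exists (rc r); rewrite /= ?rc_gt0 // => y /ball_rnP; rewrite rnC; exact: h.
Qed.

Lemma closed_rnP (U : normedModType C) (M : set U) : closed M <->
  (forall x, (forall e : R, 0 < e -> exists2 y, M y & rn (y - x) < e) -> M x).
Proof.
split=> [cM x h|h x clx].
  apply: cM => B /nbhs_rnP[r r0 rB].
  by have [y My yr] := h _ r0; exists y; split => //; exact: rB.
apply: h => e e0; have [|y [My ye]] := clx [set y | rn (y - x) < e].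
  by apply/nbhs_rnP; exists e.
by exists y.
Qed.

(** * Convergence and completeness in terms of the real-valued norm *)

Section Limits.
Context {U : normedModType C}.
Implicit Types (u v : nat -> U) (x y l : U).

Definition tends u l := forall e : R, 0 < e ->
  exists N, forall n, (N <= n)%N -> rn (u n - l) < e.

Lemma tendsP u l : (u @ \oo --> l) <-> tends u l.
Proof.
split=> [/cvgrPdist_lt h e e0|h].
  have [|N _ hN] := h (rc e); first by rewrite rc_gt0.
  by exists N => n /hN /=; rewrite rnE rc_lt rnC.
apply/cvgrPdist_lt => _ /gt0_rc[e e0 ->]; have [N hN] := h e e0.
by exists N => // n /hN; rewrite /= rnE rc_lt rnC.
Qed.

Lemma tends_cst l : tends (fun _ => l) l.
Proof. by move=> e e0; exists 0%N => n _; rewrite subrr rn0. Qed.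

Lemma tends_eq u v l : (forall n, u n = v n) -> tends u l -> tends v l.
Proof. by move=> /funext ->. Qed.

Lemma tendsD u v l m : tends u l -> tends v m ->
  tends (fun n => u n + v n) (l + m).
Proof.
move=> ul vm e e0; have e2 : 0 < e / 2 by rewrite divr_gt0.
have [[N hN] [N' hN']] := (ul _ e2, vm _ e2).
exists (maxn N N') => n; rewrite geq_max => /andP[/hN h1 /hN' h2].
rewrite opprD addrACA; move: (rnD (u n - l) (v n - m)); lra.
Qed.

Lemma tendsS u l : tends u l -> tends (fun n => u n.+1) l.
Proof. by move=> h e /h[N hN]; exists N => n Nn; apply/hN/leqW. Qed.

Lemma tends_Sr u l : tends (fun n => u n.+1) l -> tends u l.
Proof. by move=> h e /h[N hN]; exists N.+1 => -[//|n] Nn; apply/hN. Qed.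

Lemma tends_unique u l m : tends u l -> tends u m -> l = m.
Proof.
move=> ul um; apply/eqP; rewrite -subr_eq0; apply/eqP/rn_small => e e0.
have e2 : 0 < e / 2 by rewrite divr_gt0.
have [[N hN] [N' hN']] := (ul _ e2, um _ e2).
have h1 := hN _ (leq_maxl N N'); have h2 := hN' _ (leq_maxr N N').
by move: (rn_triangle (u (maxn N N')) l m); rewrite (rnC l (u _)); lra.
Qed.

Lemma tends_le u l (k : R) N : tends u l ->
  (forall n, (N <= n)%N -> rn (u n) <= k) -> rn l <= k.
Proof.
move=> ul h; rewrite leNgt; apply/negP => kl.
have [|N' hN'] := ul (rn l - k); first by rewrite subr_gt0.
have h1 := h _ (leq_maxl N N'); have h2 := hN' _ (leq_maxr N N').
by move: (rn_sub l (u (maxn N N'))); rewrite (rnC l); lra.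
Qed.

Lemma closed_tends (M : set U) u l :
  closed M -> (forall n, M (u n)) -> tends u l -> M l.
Proof.
move=> /closed_rnP cM Mu ul; apply: cM => e /ul[N hN]; exists (u N) => //.
exact: hN.
Qed.

Lemma closed_tendsP (M : set U) :
  (forall u l, (forall n, M (u n)) -> tends u l -> M l) -> closed M.
Proof.
move=> h; apply/closed_rnP => x hx.
have /choice[u hu] : forall n : nat, exists y, M y /\ rn (y - x) < n.+1%:R^-1.
  by move=> n; have [|y] := hx n.+1%:R^-1; [rewrite invr_gt0|exists y].
apply: (h u) => [n|]; first by have [] := hu n.
move=> e e0; exists (Num.bound e^-1) => n ln.
have [_] := hu n; move/lt_le_trans; apply.
rewrite invf_ple ?posrE // ?ltr0n //.
apply/ltW/(lt_le_trans (archi_boundP _)); first by rewrite invr_ge0 ltW.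
by rewrite ler_nat leqW.
Qed.

Definition cauchy_seq u := forall e : R, 0 < e ->
  exists N, forall n m, (N <= n)%N -> (N <= m)%N -> rn (u n - u m) < e.

(** Completeness is attached to subsets, so that subspaces and ranges need no types of their own in
    the Baire and open mapping theorems. *)
Definition complete_set (M : set U) := forall u,
  (forall n, M (u n)) -> cauchy_seq u -> exists2 l, M l & tends u l.

End Limits.

Lemma tends_lip (U V : normedModType C) (M : set U) (f : U -> V) (k : R) u l :
  (forall x y, M x -> M y -> rn (f x - f y) <= k * rn (x - y)) ->
  (forall n, M (u n)) -> M l -> tends u l -> tends (fun n => f (u n)) (f l).
Proof.
move=> fk Mu Ml ul e e0.
(* The sign of [k] is unknown, so [|k| + 1] serves as a positive Lipschitz constant. *)
have k0 : 0 < `|k| + 1 by have := normr_ge0 k; lra.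
have [|N hN] := ul (e / (`|k| + 1)); first by rewrite divr_gt0.
exists N => n /hN; rewrite ltr_pdivlMr // => h.
apply: le_lt_trans (fk _ _ (Mu n) Ml) (le_lt_trans _ h).
have := ler_norm k; have := rn_ge0 (u n - l); nra.
Qed.

Lemma closed_complete (X : completeNormedModType C) (M : set X) :
  closed M -> complete_set M.
Proof.
move=> cM u Mu cu.
have /cauchy_cvg/cvg_ex[l ul] : cauchy (u @ \oo).
  apply: cauchy_exP => _ /gt0_rc[e e0 ->].
  have [N hN] := cu e e0; exists (u N), N => // n /= Nn.
  by apply/ball_rnP/hN.
have {}ul : tends u l by apply/tendsP.
by exists l => //; apply: closed_tends ul.
Qed.

End RealNorm.

(** * Baire and open mapping theorems on complete subsets *)

Section OpenMapping.
Context {R : realType}.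
Local Notation C := (Cplx R).

Lemma half_lt (k e : R) : 0 <= k -> 0 < e -> exists N : nat, k * 2^-1 ^+ N < e.
Proof.
move=> k0 e0; exists (Num.bound (k / e)).
have h := archi_boundP (divr_ge0 k0 (ltW e0)).
rewrite exprVn ltr_pdivrMr ?exprn_gt0 // -ltr_pdivrMl // mulrC.
by apply: lt_le_trans h _; rewrite -natrX ler_nat ltnW // ltn_expl.
Qed.

Lemma half_le (k : R) m n : 0 <= k -> (m <= n)%N ->
  k * 2^-1 ^+ n <= k * 2^-1 ^+ m.
Proof.
move=> k0 mn; apply: ler_wpM2l => //; apply: ler_wiXn2l => //; first by rewrite invr_ge0.
by rewrite invf_le1 // ler1n.
Qed.

Lemma half_tail (U : normedModType C) (x : nat -> U) (k : R) m n :
  (m <= n)%N -> 0 <= k -> (forall i, (m <= i)%N -> rn (x i) <= k * 2^-1 ^+ i) ->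
  rn (\sum_(m <= i < n) x i) <= 2 * k * 2^-1 ^+ m.
Proof.
move=> mn k0 xk.
(* Removing the part of the geometric series beyond [n] gives a bound that passes through the
   induction on [n]. *)
suff : rn (\sum_(m <= i < n) x i) <= 2 * k * 2^-1 ^+ m - 2 * k * 2^-1 ^+ n.
  have : 0 <= 2 * k * 2^-1 ^+ n by rewrite !mulr_ge0 // exprn_ge0 // invr_ge0.
  lra.
elim: n mn => [|n ih]; first by rewrite leqn0 => /eqP->; rewrite big_nil rn0 subrr.
rewrite leq_eqVlt => /orP[/eqP->|]; first by rewrite big_geq // rn0 subrr.
rewrite ltnS => mn; rewrite big_nat_recr //=.
apply: le_trans (rnD _ _) _; have := ih mn; have := xk _ mn; rewrite exprS.
by set t := 2^-1 ^+ n; set s := 2^-1 ^+ m => h1 h2; lra.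
Qed.

Lemma half_cauchy (U : normedModType C) (x : nat -> U) (k : R) :
  0 <= k -> (forall i, rn (x i) <= k * 2^-1 ^+ i) ->
  cauchy_seq (fun n => \sum_(0 <= i < n) x i).
Proof.
move=> k0 xk e e0; have [N hN] := half_lt (mulr_ge0 (ler0n _ 2) k0) e0; exists N.
suff h n m : (N <= n)%N -> (n <= m)%N ->
    rn (\sum_(0 <= i < n) x i - \sum_(0 <= i < m) x i) < e.
  move=> n m Nn Nm; have [nm|/ltnW mn] := leqP n m; first exact: h.
  by rewrite rnC h.
move=> Nn nm; rewrite (big_cat_nat (leq0n n) nm) //= opprD addNKr rnN.
apply: le_lt_trans hN; apply: le_trans (half_tail nm k0 _) _ => //.
exact/half_le/Nn/mulr_ge0.
Qed.

(** Otherwise every relative ball of [Y] contains a smaller one at positive distance from [F n];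
    nested balls avoiding [F 0], [F 1], and so on shrink to a point of [Y] lying in no [F n]. The
    [F n] need not be closed, as only density is concluded. *)
Lemma baire (V : normedModType C) (Y : set V) (F : nat -> set V) :
  complete_set Y -> Y !=set0 -> (forall y, Y y -> exists n, F n y) ->
  exists n y0 (r : R), [/\ Y y0, 0 < r & forall y, Y y -> rn (y - y0) < r ->
    forall e, 0 < e -> exists2 z, F n z & rn (y - z) < e].
Proof.
move=> cY [y00 Yy00] FY; apply: contrapT => hn.
have step n y0 (r : R) : Y y0 -> 0 < r -> exists y (s : R),
    [/\ Y y, 0 < s, s <= r / 2, rn (y - y0) + s <= r &
        forall z, F n z -> 2 * s <= rn (y - z)].
  move=> Yy0 r0.
  have [y [Yy yr [e e0 he]]] : exists y, [/\ Y y, rn (y - y0) < r / 2 &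
      exists2 e, 0 < e & forall z, F n z -> e <= rn (y - z)].
    apply: contrapT => h; apply: hn; exists n, y0, (r / 2); split=> //.
      by rewrite divr_gt0.
    move=> y Yy yr e e0; apply: contrapT => h'; apply: h; exists y; split=> //.
    exists e => // z Fz; rewrite leNgt; apply/negP => ze; apply: h'.
    by exists z.
  (* The term [r / 2] keeps the new ball inside the old one and drives the radii to 0; [e / 2] keeps
     the new ball away from [F n]. *)
  exists y, (Num.min (r / 2) (e / 2)); split=> //.
  - by rewrite lt_min !divr_gt0.
  - by rewrite ge_min lexx.
  - have : Num.min (r / 2) (e / 2) <= r / 2 by rewrite ge_min lexx.
    lra.
  - move=> z /he; have : Num.min (r / 2) (e / 2) <= e / 2 by rewrite ge_min lexx orbT.
    lra.
pose S := (nat * V * R)%type.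
(* A state holds index, centre and radius. Nothing is asked of states violating the invariants, so
   every state has a successor, as dependent choice requires. *)
pose next (s t : S) := Y s.1.2 -> 0 < s.2 ->
  [/\ t.1.1 = s.1.1.+1, Y t.1.2, 0 < t.2, t.2 <= s.2 / 2 &
      rn (t.1.2 - s.1.2) + t.2 <= s.2 /\
      forall z, F s.1.1 z -> 2 * t.2 <= rn (t.1.2 - z)].
have nextP (s : S) : {t : S | next s t}.
  apply: cid; case: s => -[n y] r; rewrite /next /=.
  have [[Yy r0]|nh] := pselect (Y y /\ 0 < r).
    by have [y' [s [? ? ? ? ?]]] := step n y r Yy r0; exists (n.+1, y', s) => _ _; split.
  by exists (n, y, r) => Yy r0; case: nh.
have [f [f0 fS]] := dependent_choice nextP (0%N, y00, 1).
pose n_ k := (f k).1.1; pose y_ k := (f k).1.2; pose r_ k := (f k).2.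
have inv k : [/\ n_ k = k, Y (y_ k), 0 < r_ k & r_ k <= 2^-1 ^+ k].
  elim: k => [|k [nk Yk rk rk2]]; first rewrite /n_ /y_ /r_ f0 expr0.
    by split; rewrite /= ?lexx ?ltr01.
  have [e1 e2 e3 e4 _] := fS k Yk rk; split => //; first by rewrite /n_ e1 -/(n_ k) nk.
  by rewrite exprS; move: e4 rk2; rewrite -/(r_ k) -/(r_ k.+1); lra.
have nxt k : rn (y_ k.+1 - y_ k) + r_ k.+1 <= r_ k /\
    forall z, F k z -> 2 * r_ k.+1 <= rn (y_ k.+1 - z).
  have [nk Yk rk rk2] := inv k; have [_ _ _ _] := fS k Yk rk.
  by rewrite -/(n_ k) nk.
have dist k j : rn (y_ (k + j)%N - y_ k) + r_ (k + j)%N <= r_ k.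
  elim: j => [|j ih]; first by rewrite addn0 subrr rn0 add0r.
  have [h _] := nxt (k + j)%N; rewrite addnS.
  have := rn_triangle (y_ (k + j)%N) (y_ (k + j).+1) (y_ k); lra.
have rlt k e : 2^-1 ^+ k < e -> r_ k < e.
  by move=> h; have [_ _ _ rk] := inv k; apply: le_lt_trans h.
have cy : cauchy_seq y_.
  move=> e e0; have e2 : 0 < e / 2 by rewrite divr_gt0.
  have [N] := half_lt ler01 e2; rewrite mul1r => /rlt hN.
  exists N => n m Nn Nm.
  have h p : (N <= p)%N -> rn (y_ p - y_ N) < e / 2.
    move=> Np; have := dist N (p - N)%N; rewrite subnKC //.
    by have [_ _ rp _] := inv p; lra.
  have := rn_triangle (y_ N) (y_ n) (y_ m).
  by rewrite (rnC (y_ N)); have := h _ Nn; have := h _ Nm; lra.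
have [l Yl yl] : exists2 l, Y l & tends y_ l.
  by apply: cY cy => k; have [] := inv k.
(* The limit [l] lies in some [F n], hence at distance at least [2 * r_ n.+1] from [y_ n.+1]; a late
   centre is within [r_ n.+1] of both, a contradiction. *)
have [n Fn] := FY l Yl.
have [_ /(_ l Fn) h1] := nxt n.
have [_ _ r0 _] := inv n.+1.
have [N hN] := yl _ r0.
have := hN _ (leq_maxr n.+1 N).
have := dist n.+1 (maxn n.+1 N - n.+1)%N; rewrite subnKC ?leq_maxl //.
have [_ _ rm _] := inv (maxn n.+1 N).
have := rn_triangle (y_ (maxn n.+1 N)) (y_ n.+1) l; rewrite (rnC (y_ n.+1) (y_ _)).
lra.
Qed.

(** Convertible with [is_subspace], but over any module, so that it also covers subsets of a
    product. *)
Definition subspace_set (U : lmodType C) (M : set U) :=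
  M 0 /\ forall (a : C) (x y : U), M x -> M y -> M (a *: x + y).

(** * Subspaces and maps that are linear on them *)

Section Subspace.
Context {U V : lmodType C}.
Implicit Types (M : set U) (A : U -> V).

Definition linear_on M A :=
  forall (a : C) (x y : U), M x -> M y -> A (a *: x + y) = a *: A x + A y.

Lemma subspaceD M x y : subspace_set M -> M x -> M y -> M (x + y).
Proof. by move=> sM Mx My; rewrite -(scale1r x); apply: sM.2. Qed.

Lemma subspaceZ M a x : subspace_set M -> M x -> M (a *: x).
Proof. by move=> sM Mx; rewrite -(addr0 (_ *: _)); apply: sM.2 => //; case: sM. Qed.

Lemma subspaceN M x : subspace_set M -> M x -> M (- x).
Proof. by move=> sM Mx; rewrite -scaleN1r; exact: subspaceZ. Qed.

Lemma subspaceB M x y : subspace_set M -> M x -> M y -> M (x - y).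
Proof. by move=> sM Mx My; apply: subspaceD => //; apply: subspaceN. Qed.

Lemma subspace_sum M (I : Type) (r : seq I) (F : I -> U) :
  subspace_set M -> (forall i, M (F i)) -> M (\sum_(i <- r) F i).
Proof.
move=> sM MF; elim/big_ind: _ => //; first by case: sM.
by move=> x y; apply: subspaceD.
Qed.

Context {M : set U} {A : U -> V}.
Context (sM : subspace_set M) (lA : linear_on M A).

Lemma linear_onD x y : M x -> M y -> A (x + y) = A x + A y.
Proof. by move=> Mx My; rewrite -{1}(scale1r x) lA // scale1r. Qed.

Lemma linear_on0 : A 0 = 0.
Proof.
have M0 := sM.1; have /eqP := linear_onD M0 M0.
by rewrite addr0 -subr_eq0 opprD addNKr oppr_eq0 => /eqP.
Qed.

Lemma linear_onZ a x : M x -> A (a *: x) = a *: A x.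
Proof.
by move=> Mx; rewrite -[in LHS](addr0 (a *: x)) lA ?linear_on0 ?addr0//; case: sM.
Qed.

Lemma linear_onN x : M x -> A (- x) = - A x.
Proof. by move=> Mx; rewrite -scaleN1r linear_onZ // scaleN1r. Qed.

Lemma linear_onB x y : M x -> M y -> A (x - y) = A x - A y.
Proof. by move=> Mx My; rewrite linear_onD ?linear_onN //; apply: subspaceN. Qed.

Lemma linear_on_sum (I : Type) (r : seq I) (F : I -> U) :
  (forall i, M (F i)) -> A (\sum_(i <- r) F i) = \sum_(i <- r) A (F i).
Proof.
move=> MF; elim: r => [|i r ih]; first by rewrite !big_nil linear_on0.
by rewrite !big_cons linear_onD ?ih //; apply: subspace_sum.
Qed.

Lemma subspace_image : subspace_set (A @` M).
Proof.
split; first by exists 0; [case: sM|exact: linear_on0].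
move=> a _ _ [x Mx <-] [y My <-]; exists (a *: x + y); first exact: sM.2.
by rewrite lA.
Qed.

End Subspace.

(** By Baire, the image of some ball is dense near a point of the range, hence, by differences and
    scaling, every image is approximated with control of the norm. Correcting the error repeatedly
    gives an exact preimage as the sum of a series. *)
Theorem open_mapping (U V : normedModType C) (M : set U) (A : U -> V) (b : R) :
  subspace_set M -> linear_on M A -> (forall x, M x -> rn (A x) <= b * rn x) ->
  complete_set M -> complete_set (A @` M) ->
  exists2 k, 0 < k &
    forall x, M x -> exists z, [/\ M z, A z = A x & rn z <= k * rn (A x)].
Proof.
move=> sM lA bA cM cY.
have sY := subspace_image sM lA.
pose F n := A @` [set x | M x /\ rn x <= n%:R].
have [|||n [y0 [r [Yy0 r0 dense]]]] := @baire V (A @` M) F.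
- exact: cY.
- by exists 0; case: sY.
- move=> _ [x Mx <-]; exists (Num.bound (rn x)), x => //; split => //.
  exact/ltW/archi_boundP/rn_ge0.
(* Here [y] is the difference of [y + y0] and [y0], both close to images of vectors of norm at most
   [n]. *)
have ball_dense y e : (A @` M) y -> rn y < r -> 0 < e ->
    exists x, [/\ M x, rn x <= 2 * n%:R & rn (y - A x) < e].
  move=> Yy yr e0; have e2 : 0 < e / 2 by rewrite divr_gt0.
  have [||_ [x1 [Mx1 x1n] <-] h1] := dense (y + y0) _ _ _ e2.
  - exact: subspaceD.
  - by rewrite addrK.
  have [||_ [x0 [Mx0 x0n] <-] h0] := dense y0 _ _ _ e2 => //.
    by rewrite subrr rn0.
  exists (x1 - x0); split; first exact: subspaceB.
    by have := rnB x1 x0; lra.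
  rewrite (linear_onB sM lA) //.
  have -> : y - (A x1 - A x0) = (y + y0 - A x1) - (y0 - A x0).
    by rewrite !opprB [RHS]addrACA (addrAC y) (addrC (- A x1)) [RHS]addrA addrK addrA.
  by have := rnB (y + y0 - A x1) (y0 - A x0); lra.
(* A nonzero [y] is rescaled to norm [r / 2], where preimages have norm at most [2 * n]; the
   quotient of the two is [k]. *)
pose k : R := 4 * n%:R / r.
have k0 : 0 <= k by rewrite !mulr_ge0 // ?ler0n // invr_ge0 ltW.
have approx y e : (A @` M) y -> 0 < e ->
    exists x, [/\ M x, rn x <= k * rn y & rn (y - A x) < e].
  move=> Yy e0; have [->|/eqP yn0] := eqVneq y 0.
    exists 0; split; first by case: sM.
      by rewrite !rn0 mulr0.
    by rewrite (linear_on0 sM lA) subrr rn0.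
  have ny := rn_gt0 yn0; pose t : R := r / (2 * rn y).
  have t0 : 0 < t by rewrite divr_gt0 // mulr_gt0.
  have rt : rn (rc t) = t by rewrite rn_rc // ltW.
  have tn0 : rc t != 0 :> C by rewrite gt_eqF // rc_gt0.
  have [|||x [Mx xn xy]] := @ball_dense (rc t *: y) (t * e).
  - exact: subspaceZ.
  - rewrite rnZ rt; suff -> : t * rn y = r / 2 by lra.
    by rewrite /t; field; rewrite gt_eqF.
  - exact: mulr_gt0.
  exists ((rc t)^-1 *: x); split; first exact: subspaceZ.
    rewrite rnZ rnV rt ler_pdivrMl //; apply: le_trans xn _.
    suff -> : t * (k * rn y) = 2 * n%:R by [].
    by rewrite /t /k; field; rewrite !gt_eqF.
  rewrite (linear_onZ sM lA) //.
  rewrite -(ltr_pM2l t0) -{1}rt -rnZ scalerBr scalerA divff // scale1r.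
  exact: xy.
exists (2 * k + 1); first by lra.
move=> x Mx; have [Ax0|/eqP Axn0] := eqVneq (A x) 0.
  exists 0; split; first by case: sM.
    by rewrite Ax0 (linear_on0 sM lA).
  by rewrite Ax0 !rn0 mulr0.
have ny := rn_gt0 Axn0.
(* A state is what remains of [x] together with a step counter. Each step subtracts a vector [w]
   controlled by the current error and halves the bound on that error. *)
pose next (s t : U * nat) := t.2 = s.2.+1 /\ (M s.1 -> exists w,
  [/\ M w, t.1 = s.1 - w, rn w <= k * rn (A s.1) &
      rn (A t.1) <= rn (A x) * 2^-1 ^+ t.2]).
have nextP (s : U * nat) : {t : U * nat | next s t}.
  apply: cid; case: s => s m; rewrite /next /=.
  have [Ms|nMs] := pselect (M s); last by exists (s, m.+1).
  have [||w [Mw ws we]] := @approx (A s) (rn (A x) * 2^-1 ^+ m.+1).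
  - by exists s.
  - by rewrite mulr_gt0 // exprn_gt0 // invr_gt0.
  exists (s - w, m.+1); split => // _; exists w; split => //=.
  by rewrite (linear_onB sM lA) // ltW.
have [f [f0 fS]] := dependent_choice nextP (x, 0%N).
have inv m : [/\ M (f m).1, (f m).2 = m & rn (A (f m).1) <= rn (A x) * 2^-1 ^+ m].
  elim: m => [|m [Mm em hm]]; first by rewrite f0 expr0 mulr1; split.
  have [e1 /(_ Mm)[w [Mw e2 h3 h4]]] := fS m; split.
  - by rewrite e2; apply: subspaceB.
  - by rewrite e1 em.
  - by move: h4; rewrite e1 em.
pose w m := (f m).1 - (f m.+1).1.
have Mw m : M (w m) by apply: subspaceB => //; [have [] := inv m|have [] := inv m.+1].
have wk m : rn (w m) <= k * rn (A x) * 2^-1 ^+ m.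
  have [Mm em hm] := inv m; have [_ /(_ Mm)[w' [_ e2 h3 _]]] := fS m.
  rewrite /w e2 subKr -mulrA; apply: le_trans h3 _.
  exact: ler_wpM2l.
have sumw m : \sum_(0 <= i < m) w i = x - (f m).1.
  elim: m => [|m ih]; first by rewrite big_nil f0 subrr.
  by rewrite big_nat_recr //= ih /w subrKA.
have kx0 : 0 <= k * rn (A x) by rewrite mulr_ge0 // rn_ge0.
have [|z Mz wz] := cM _ _ (half_cauchy kx0 wk).
  by move=> m; apply: subspace_sum.
exists z; split => //.
  apply: (@tends_unique _ _ (fun m => A (\sum_(0 <= i < m) w i))).
    apply: (tends_lip (M := M) (k := b)) => // [u v Mu Mv|m].
      by rewrite -(linear_onB sM lA) //; apply: bA; apply: subspaceB.
    exact: subspace_sum.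
  move=> e e0; have [N hN] := half_lt (ltW ny) e0; exists N => m Nm.
  rewrite sumw; have [Mm _ hm] := inv m.
  rewrite (linear_onB sM lA) // addrAC subrr sub0r rnN.
  exact/(le_lt_trans hm)/(le_lt_trans _ hN)/half_le/Nm/ltW.
apply: (@le_trans _ _ (2 * (k * rn (A x)))); last by lra.
apply: (tends_le (N := 0%N) wz) => m _.
by have := @half_tail _ w _ 0%N m isT kx0 (fun i _ => wk i); rewrite expr0 mulr1.
Qed.

End OpenMapping.

(** * Power series with vector coefficients *)

Section PowerSeries.
Context {R : realType}.
Local Notation C := (Cplx R).

Lemma tendsZ (U : normedModType C) (a : C) (u : nat -> U) l :
  tends u l -> tends (fun n => a *: u n) (a *: l).
Proof.
apply: (tends_lip (M := setT) (k := rn a)) => // x y _ _.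
by rewrite -scalerBr rnZ.
Qed.

Lemma tends_bounded (U : normedModType C) (u : nat -> U) l :
  tends u l -> exists2 b : R, 0 <= b & forall n, rn (u n) <= b.
Proof.
move=> ul; have [N hN] := ul 1 ltr01.
have s0 : 0 <= \sum_(i < N) rn (u i) by apply: sumr_ge0 => i _; apply: rn_ge0.
have l0 := rn_ge0 l.
exists (\sum_(i < N) rn (u i) + (rn l + 1)) => [|n]; first by lra.
have [Nn|nN] := leqP N n.
  by have := rn_sub (u n) l; have := hN _ Nn; lra.
rewrite (bigD1 (Ordinal nN)) //=.
have : 0 <= \sum_(i < N | i != Ordinal nN) rn (u i).
  by apply: sumr_ge0 => i _; apply: rn_ge0.
lra.
Qed.

Context {U : normedModType C}.
Implicit Types (c d : nat -> U) (f g : C -> U) (w : C) (s : R).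

Definition psum c w n := \sum_(0 <= k < n) w ^+ k *: c k.

Definition psconv c f s := forall w, rn w < s -> tends (psum c w) (f w).

Lemma psumS c w n : psum c w n.+1 = c 0%N + w *: psum (fun k => c k.+1) w n.
Proof.
rewrite /psum big_nat_recl // expr0 scale1r scaler_sumr; congr (_ + _).
by apply: eq_bigr => i _; rewrite scalerA -exprS.
Qed.

Lemma psum0 c n : psum c 0 n.+1 = c 0%N.
Proof. by rewrite psumS scale0r addr0. Qed.

Lemma psconv0 c f s : 0 < s -> psconv c f s -> f 0 = c 0%N.
Proof.
move=> s0 cf; apply: (tends_unique (u := fun n => psum c 0 n.+1)).
  by apply/tendsS/cf; rewrite rn0.
by apply: tends_eq (tends_cst _) => n; rewrite psum0.
Qed.

(** Convergence at radius [s / 2] bounds the terms there; for [rn w < s / 4] the terms after [c 0]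
    are then dominated by a geometric series of ratio 1/2 carrying a factor [rn w]. *)
Lemma psconv_near c f s : 0 < s -> psconv c f s ->
  exists k e : R, [/\ 0 <= k, 0 < e &
    forall w, rn w < e -> rn (f w - c 0%N) <= k * rn w].
Proof.
move=> s0 cf; have s2 : 0 < s / 2 by rewrite divr_gt0.
have rs2 : rn (rc (s / 2)) = s / 2 by rewrite rn_rc // ltW.
have [|b b0 hb] := tends_bounded (cf (rc (s / 2)) _).
  by rewrite rs2; lra.
have ck k : (s / 2) ^+ k * rn (c k) <= 2 * b.
  have -> : (s / 2) ^+ k * rn (c k) = rn (psum c (rc (s / 2)) k.+1 - psum c (rc (s / 2)) k).
    by rewrite /psum big_nat_recr //= addrAC subrr add0r rnZ rnX rs2.
  by apply: le_trans (rnB _ _) _; have := hb k; have := hb k.+1; lra.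
exists (8 * b / s), (s / 4); split => [||w ws].
- by rewrite !mulr_ge0 // invr_ge0 ltW.
- by rewrite divr_gt0.
pose t := rn w / (s / 2).
have t0 : 0 <= t by rewrite divr_ge0 ?rn_ge0 // ltW.
have t2 : t <= 2^-1 by rewrite ler_pdivrMr //; lra.
have rw : rn w = t * (s / 2) by rewrite divfK // gt_eqF.
clearbody t.
have term k : (1 <= k)%N -> rn (w ^+ k *: c k) <= 4 * b * t * 2^-1 ^+ k.
  case: k => // k _; rewrite rnZ rnX rw exprMn -(mulrA (t ^+ _)).
  have h1 := ck k.+1; have h2 : t ^+ k <= 2^-1 ^+ k.
    by rewrite lerXn2r // nnegrE invr_ge0.
  have h3 : 0 <= t ^+ k by rewrite exprn_ge0.
  apply: (@le_trans _ _ (t ^+ k.+1 * (2 * b))).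
    by apply: ler_wpM2l => //; rewrite exprn_ge0.
  rewrite !exprS; have : t * b * t ^+ k <= t * b * 2^-1 ^+ k.
    by apply: ler_wpM2l => //; rewrite mulr_ge0.
  lra.
have wlt : rn w < s by lra.
have k0 : 0 <= 4 * b * t by rewrite !mulr_ge0.
have lim : tends (fun n => psum c w n.+1 - c 0%N) (f w - c 0%N).
  by apply: tendsD (tends_cst _); apply/tendsS/cf.
suff -> : 8 * b / s * rn w = 2 * (4 * b * t) * 2^-1 ^+ 1.
  apply: (tends_le (N := 0%N) lim) => n _.
  rewrite /psum big_ltn // expr0 scale1r addrAC subrr add0r.
  exact: half_tail.
by rewrite rw expr1; field; rewrite gt_eqF.
Qed.

(** The difference quotient at 0 is completed by its limit [c 1], since division by [w = 0] would
    give a wrong value. *)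
Lemma psconv_shift c f s : psconv c f s ->
  psconv (fun k => c k.+1)
    (fun w => if w == 0 then c 1%N else w^-1 *: (f w - c 0%N)) s.
Proof.
move=> cf w ws; have [->|w0] := eqVneq w 0.
  by apply: tends_Sr; apply: tends_eq (tends_cst _) => n; rewrite psum0.
apply: (@tends_eq _ _ (fun n => w^-1 *: (psum c w n.+1 - c 0%N))) => [n|].
  by rewrite psumS addrAC subrr add0r scalerA mulVf // scale1r.
by apply/tendsZ/tendsD/tends_cst/tendsS/cf.
Qed.

(** The coefficient [c 0] is a limit of values in [Y]; passing to the difference quotient, which
    again takes values in [Y], reaches the later ones. With [Y] zero this is uniqueness of
    coefficients, with [Y] a closed range it locates them. *)
Lemma psconv_coef (Y : set U) c f s : subspace_set Y -> closed Y ->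
  0 < s -> psconv c f s ->
  (forall e : R, 0 < e -> exists w, [/\ w <> 0, rn w < e & Y (f w)]) ->
  forall k, Y (c k).
Proof.
move=> sY cY s0 cf hY k.
suff c0 d g : psconv d g s -> (forall e : R, 0 < e ->
    exists w, [/\ w <> 0, rn w < e & Y (g w)]) -> Y (d 0%N).
  elim: k c f cf hY => [|k ih] c f cf hY; first exact: c0 hY.
  have Yc0 := c0 _ _ cf hY.
  apply: (ih _ _ (psconv_shift cf)) => e /hY[w [w0 we Yw]].
  exists w; split=> //; case: eqP => // _.
  by apply: subspaceZ => //; apply: subspaceB.
move=> dg hg; move: cY => /closed_rnP; apply => e e0.
have [b [e' [b0 e'0 near]]] := psconv_near s0 dg.
have [|w [_ we Yw]] := hg (Num.min e' (e / (b + 1))).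
  by rewrite lt_min e'0 divr_gt0 //; lra.
move: we; rewrite lt_min ltr_pdivlMr; last by lra.
move=> /andP[/near h1 h2]; exists (g w) => //.
by apply: le_lt_trans h1 _; have := rn_ge0 w; lra.
Qed.

Lemma subspace_set_zero : subspace_set [set (0 : U)].
Proof. by split => // a _ _ -> ->; rewrite /= scaler0 addr0. Qed.

Lemma closed_set_zero : closed [set (0 : U)].
Proof.
by apply/closed_rnP => x hx; apply: rn_small => e /hx[_ ->]; rewrite sub0r rnN.
Qed.

Lemma psconv_eq0 c f s : 0 < s -> psconv c f s ->
  (forall e : R, 0 < e -> exists w, [/\ w <> 0, rn w < e & f w = 0]) ->
  forall k, c k = 0.
Proof. by move=> s0 cf h; apply: (psconv_coef subspace_set_zero closed_set_zero s0 cf). Qed.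

Lemma psconvD c d f g s : psconv c f s -> psconv d g s ->
  psconv (fun k => c k + d k) (fun w => f w + g w) s.
Proof.
move=> cf dg w ws; apply: tends_eq (tendsD (cf w ws) (dg w ws)) => n.
by rewrite /psum -big_split /=; apply: eq_bigr => i _; rewrite scalerDr.
Qed.

Lemma psconvX c f s : psconv c f s ->
  psconv (fun k => if k is k'.+1 then c k' else 0) (fun w => w *: f w) s.
Proof.
move=> cf w ws; apply: tends_Sr; apply: tends_eq (tendsZ w (cf w ws)) => n.
by rewrite psumS add0r.
Qed.

Lemma psconv_monom q (x : U) s :
  psconv (fun k => if k == q then x else 0) (fun w => w ^+ q *: x) s.
Proof.
elim: q => [|q ih] w ws.
  apply: tends_Sr; apply: tends_eq (tends_cst _) => n.
  by rewrite psumS /= /psum big1 ?scaler0 ?addr0 ?expr0 ?scale1r // => i _; rewrite scaler0.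
rewrite exprS -scalerA; apply: tends_eq (psconvX ih ws) => n.
by apply: eq_bigr => -[|i].
Qed.

Lemma psconv_map (V : normedModType C) (M : set U) (A : U -> V) (b : R) c f s :
  subspace_set M -> linear_on M A -> (forall x, M x -> rn (A x) <= b * rn x) ->
  (forall k, M (c k)) -> (forall w, rn w < s -> M (f w)) -> psconv c f s ->
  forall w, rn w < s ->
    tends (fun n => \sum_(0 <= k < n) w ^+ k *: A (c k)) (A (f w)).
Proof.
move=> sM lA bA Mc Mf cf w ws.
have Mcw k : M (w ^+ k *: c k) by apply: subspaceZ.
apply: tends_eq (tends_lip (M := M) (k := b) _ _ (Mf _ ws) (cf w ws)) => [n|x y Mx My|n].
- rewrite /psum (linear_on_sum sM lA) //.
  by apply: eq_bigr => i _; rewrite (linear_onZ sM lA).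
- by rewrite -(linear_onB sM lA) //; apply: bA; apply: subspaceB.
- exact: subspace_sum.
Qed.

End PowerSeries.

(** * Identity theorem *)

Section Identity.
Context {R : realType} {X : completeNormedModType (Cplx R)}.
Local Notation C := (Cplx R).
Implicit Types (f : C -> X) (a b z : C) (r : R).

Lemma ballrcP a r z : ball a (rc r) z <-> rn (z - a) < r.
Proof. by rewrite rnC; apply: ball_rnP. Qed.

Lemma ball_shift a r b : rn (b - a) < r ->
  forall w : C, rn w < r - rn (b - a) -> rn (b + w - a) < r.
Proof. by move=> ba w hw; have := rnD (b - a) w; rewrite addrAC; lra. Qed.

Lemma analytic_psconv f z0 r a : analytic_on (ball z0 (rc r)) f ->
  rn (a - z0) < r -> exists2 s : R, 0 < s & exists2 c : nat -> X,
    psconv c (fun w => f (a + w)) s &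
    forall w : C, rn w < s -> rn (a + w - z0) < r.
Proof.
move=> an ar; have [|s0 [c [/gt0_rc[s sp ->] cf]]] := an a; first exact/ballrcP.
exists (Num.min s (r - rn (a - z0))); first by rewrite lt_min sp subr_gt0.
exists c => w; rewrite lt_min => /andP[ws wr]; last exact: ball_shift.
apply/tendsP; have := cf (a + w); rewrite addrAC subrr add0r; apply.
by apply/ballrcP; rewrite addrAC subrr add0r.
Qed.

Definition locally_zero f a :=
  exists2 e : R, 0 < e & forall z, rn (z - a) < e -> f z = 0.

(** If zeros other than [a] accumulate at [a], all Taylor coefficients at [a] vanish. *)
Lemma locally_zero_or_isolated f z0 r a : analytic_on (ball z0 (rc r)) f ->
  rn (a - z0) < r -> locally_zero f a \/
  exists2 e : R, 0 < e & forall z, z <> a -> rn (z - a) < e -> f z <> 0.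
Proof.
move=> an /(analytic_psconv an)[s s0 [c cf _]].
have [c0|/existsNP[k ck]] := pselect (forall k, c k = 0).
  left; exists s => // z za; have /= := cf _ za; rewrite (addrC a) subrK => h.
  apply: tends_unique h _; apply: tends_eq (tends_cst _) => n.
  by rewrite /psum big1 // => i _; rewrite c0 scaler0.
right; apply: contrapT => h; apply: ck; apply: (psconv_eq0 s0 cf) => e e0.
apply: contrapT => h'; apply: h; exists e => // z za ze fz; apply: h'.
exists (z - a); split=> //; last by rewrite /= (addrC a) subrK.
by move/eqP; rewrite subr_eq0 => /eqP.
Qed.

(** Connectedness of the segment from [b] to [z]: the supremum of the parameters where [f] is
    locally zero is such a parameter and cannot be below 1. *)
Lemma identity_theorem f z0 r b : analytic_on (ball z0 (rc r)) f ->
  rn (b - z0) < r -> locally_zero f b -> forall z, rn (z - z0) < r -> f z = 0.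
Proof.
move=> an br lzb z zr.
pose g (t : R) : C := b + rc t * (z - b).
have gB t u : rn (g t - g u) = `|t - u| * rn (z - b).
  rewrite /g opprD addrACA subrr add0r -mulrBl rnM; congr (_ * _).
  rewrite -[rc t - rc u]/(rc t - rc u) -(rmorphB (real_complex R)).
  by rewrite /rn normc_def /= expr0n /= addr0 sqrtr_sqr.
have gr t : 0 <= t -> t <= 1 -> rn (g t - z0) < r.
  move=> t0 t1; have -> : g t - z0 = rc (1 - t) * (b - z0) + rc t * (z - z0).
    by rewrite /g /rc rmorphB rmorph1 /=; ring.
  apply: le_lt_trans (rnD _ _) _; rewrite !rnM !rn_rc ?subr_ge0 //.
  move: br zr; set B := rn (b - z0); set Z := rn (z - z0) => Br Zr.
  have [BZ|/ltW ZB] := leP B Z.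
    have : 0 <= (1 - t) * (Z - B) by rewrite mulr_ge0 // subr_ge0.
    lra.
  have : 0 <= t * (B - Z) by rewrite mulr_ge0 // subr_ge0.
  lra.
pose E : set R := [set t | [/\ 0 <= t, t <= 1 & locally_zero f (g t)]].
have g0 : g 0 = b by rewrite /g /rc rmorph0 mul0r addr0.
have g1 : g 1 = z by rewrite /g /rc rmorph1 mul1r addrC subrK.
have E0 : E 0 by split => //; rewrite g0.
have supE : has_sup E by split; [exists 0|exists 1 => t []].
have zb1 : 0 < rn (z - b) + 1 by rewrite ltr_wpDl ?rn_ge0.
have t0 : 0 <= sup E by apply: sup_upper_bound.
have t1 : sup E <= 1 by apply: ge_sup => [|t []//]; exists 0.
have zb0 := rn_ge0 (z - b).
have [[e e0 fe]|[e e0 fe]] := locally_zero_or_isolated an (gr _ t0 t1).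
  (* A parameter step of at most [d] moves the point by at most [e / 2], leaving room for a ball of
     radius [e / 2]. Hence a supremum below 1 could be exceeded. *)
  pose d := e / (2 * (rn (z - b) + 1)).
  have d0 : 0 < d by rewrite divr_gt0 //; lra.
  have dz : d * (rn (z - b) + 1) = e / 2 by rewrite /d; field; lra.
  have [st|ts] := leP 1 (sup E).
    by apply: fe; rewrite -{1}g1 gB (_ : 1 - sup E = 0) ?normr0 ?mul0r //; lra.
  pose u := Num.min 1 (sup E + d).
  have su : sup E < u by rewrite lt_min ts; lra.
  have ud : u - sup E <= d by rewrite lerBlDl ge_min lexx orbT.
  exfalso; suff /(sup_upper_bound supE) : E u by lra.
  split; [by apply: le_trans t0 (ltW su)|by rewrite ge_min lexx|].
  exists (e / 2) => [|y yu]; first by rewrite divr_gt0.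
  apply: fe; have := rn_triangle (g u) y (g (sup E)).
  by rewrite gB ger0_norm; [nra|lra].
pose d := e / (rn (z - b) + 1).
have d0 : 0 < d by rewrite divr_gt0.
have dz : d * (rn (z - b) + 1) = e by rewrite divfK // gt_eqF.
have [u [u0 u1 [e' e'0 fu]] ud] := sup_adherent d0 supE.
have us : u <= sup E by apply: (sup_upper_bound supE); split=> //; exists e'.
have gu : rn (g u - g (sup E)) < e.
  by rewrite gB ler0_norm; [nra|lra].
(* If [g u] differs from the supposedly isolated centre, it is itself a forbidden zero; if they
   coincide, as when [z = b], the nearby point [g u + h] is one. *)
have [ug|ug] := pselect (g u = g (sup E)); last first.
  by case: (fe _ ug gu); apply: fu; rewrite subrr rn0.
pose m := Num.min e e'.
have m0 : 0 < m by rewrite lt_min e0 e'0.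
have me : m <= e by rewrite ge_min lexx.
have me' : m <= e' by rewrite ge_min lexx orbT.
pose h := m / 2.
have [h0 he he'] : [/\ 0 < h, h < e & h < e'] by rewrite /h; split; lra.
have hd : rn (g u + rc h - g u) = h by rewrite addrAC subrr add0r rn_rc // ltW.
case: (fe (g u + rc h)); rewrite -?ug ?hd //.
  by move/eqP; rewrite -subr_eq0 addrAC subrr add0r => /eqP h'; move: hd;
    rewrite addrAC subrr add0r h' rn0; lra.
by apply: fu; rewrite hd.
Qed.

End Identity.

(** * Finite ascent and SVEP *)

Section LocalSVEP.
Context {R : realType} {X : completeNormedModType (Cplx R)}.
Local Notation C := (Cplx R).
Context (T : {linear X -> X}).
Context (cT : continuous T).

Lemma linear_continuous_rn : exists2 b : R, 0 <= b & forall x, rn (T x) <= b * rn x.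
Proof.
have /nbhs_rnP[e e0 he] : nbhs (0 : X) (T @^-1` [set y | rn y < 1]).
  by apply: cT; apply/nbhs_rnP; exists 1 => // y; rewrite linear0 subr0.
exists (2 / e) => [|x]; first by rewrite divr_ge0 // ltW.
have [->|/eqP/rn_gt0 x0] := eqVneq x 0; first by rewrite linear0 !rn0 mulr0.
pose t := e / (2 * rn x).
have t0 : 0 < t by rewrite divr_gt0 // mulr_gt0.
have te : t * rn x = e / 2 by rewrite /t; field; rewrite gt_eqF.
have := he (rc t *: x); rewrite subr0 rnZ (rn_rc (ltW t0)) te.
rewrite /= linearZ /= rnZ (rn_rc (ltW t0)) => /(_ ltac:(lra)) h.
suff -> : 2 / e * rn x = t^-1 by rewrite -[leRHS]mulr1 ler_pdivlMl // ltW.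
by rewrite /t; field; rewrite !gt_eqF.
Qed.

Lemma subspaceT (U : lmodType C) : subspace_set (setT : set U).
Proof. by []. Qed.

Context (lambda : C).
Let A := sub_scalar T lambda.

Lemma sub_scalar_linear M : linear_on M A.
Proof.
move=> a x y _ _; rewrite /A /sub_scalar linearP scalerBr !scalerDr opprD !scalerA.
by rewrite addrACA (mulrC a).
Qed.

Lemma sub_scalar_bounded : exists2 b : R, 0 <= b & forall x, rn (A x) <= b * rn x.
Proof.
have [b b0 hb] := linear_continuous_rn.
exists (b + rn lambda) => [|x]; first by rewrite addr_ge0 // rn_ge0.
by apply: le_trans (rnB _ _) _; rewrite rnZ mulrDl lerD2r.
Qed.

Lemma iter_linear M n : (forall x, M x -> M (A x)) -> linear_on M (iter n A).
Proof.
move=> MA; elim: n => [|n ih] a x y Mx My //=.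
by rewrite ih //; apply: (@sub_scalar_linear setT).
Qed.

Lemma iter_linearT n : linear_on setT (iter n A).
Proof. exact: iter_linear. Qed.

Lemma iter_bounded n : exists2 b : R, 0 <= b & forall x, rn (iter n A x) <= b * rn x.
Proof.
have [b b0 hb] := sub_scalar_bounded.
exists (b ^+ n) => [|x]; first by rewrite exprn_ge0.
elim: n => [|n ih]; first by rewrite expr0 mul1r.
rewrite iterS exprS -mulrA; apply: le_trans (hb _) _.
exact: ler_wpM2l.
Qed.

(* Near lambda an eigenvector function has a backward orbit under A as its
   coefficients, and these lie in ran (A ^ n); finite ascent kills such an orbit
   starting in the kernel. *)
Lemma finite_ascent_locally_zero (f : C -> X) z0 r n :
  analytic_on (ball z0 (rc r)) f -> rn (lambda - z0) < r ->
  (forall z, rn (z - z0) < r -> sub_scalar T z (f z) = 0) ->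
  closed (ran (iter n A) setT) -> finite_ascent A (ran (iter n A) setT) ->
  locally_zero f lambda.
Proof.
move=> an lr Tf cY [p hp].
have [s s0 [c cf ws]] := analytic_psconv an lr.
have Af w : rn w < s -> A (f (lambda + w)) = w *: f (lambda + w).
  move=> /ws /Tf /eqP; rewrite subr_eq0 scalerDl => /eqP Tfw.
  by rewrite /A /sub_scalar Tfw addrAC subrr add0r.
have [b b0 hb] := sub_scalar_bounded.
have e1 : psconv (fun k => A (c k)) (fun w => A (f (lambda + w))) s.
  exact: (psconv_map (M := setT) (b := b) (@subspaceT X)
    (@sub_scalar_linear setT) (fun x _ => hb x) (fun _ => I) (fun _ _ => I) cf).
have e2 : psconv (fun k => - (if k is k'.+1 then c k' else 0))
    (fun w => - (w *: f (lambda + w))) s.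
  apply: (psconv_map (M := setT) (A := -%R) (b := 1) (@subspaceT X)) => //.
  - by move=> a x y _ _; rewrite opprD scalerN.
  - by move=> x _; rewrite rnN mul1r.
  - exact: psconvX cf.
(* Coefficient comparison in A f(lambda + w) = w f(lambda + w): the coefficients form a backward
   orbit of [A] starting in its kernel. *)
have coef : forall k, A (c k) - (if k is k'.+1 then c k' else 0) = 0.
  apply: (psconv_eq0 s0 (psconvD e1 e2)) => e e0.
  have m0 : 0 < Num.min e s / 2 by rewrite divr_gt0 // lt_min e0.
  have h1 : Num.min e s <= e by rewrite ge_min lexx.
  have h2 : Num.min e s <= s by rewrite ge_min lexx orbT.
  exists (rc (Num.min e s / 2)); rewrite rn_rc ?(ltW m0) //; split; [|lra|].
    by move/(congr1 rn); rewrite rn_rc ?(ltW m0) // rn0; lra.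
  by rewrite Af ?subrr // rn_rc ?(ltW m0) //; lra.
have A0 : A (c 0%N) = 0 by have := coef 0%N; rewrite subr0.
have AS k : A (c k.+1) = c k by apply/eqP; rewrite -subr_eq0; apply/eqP; exact: (coef k.+1).
have sY : subspace_set (ran (iter n A) setT).
  exact: subspace_image (@subspaceT X) (@iter_linearT n).
(* For small [w <> 0] the same equation writes f(lambda + w) as the image under A^n of w^(-n)
   f(lambda + w), so the values lie in the closed range. *)
have Yc k : ran (iter n A) setT (c k).
  apply: (psconv_coef sY cY s0 cf) => e e0.
  have m0 : 0 < Num.min e s / 2 by rewrite divr_gt0 // lt_min e0.
  have h1 : Num.min e s <= e by rewrite ge_min lexx.
  have h2 : Num.min e s <= s by rewrite ge_min lexx orbT.
  set w := rc (Num.min e s / 2).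
  have wE : rn w = Num.min e s / 2 by rewrite rn_rc ?(ltW m0).
  have w0 : w != 0 by apply/eqP => /(congr1 rn); rewrite rn0 wE; lra.
  exists w; split; [exact/eqP|by rewrite wE; lra|].
  have it m : iter m A (f (lambda + w)) = w ^+ m *: f (lambda + w).
    elim: m => [|m ih]; first by rewrite expr0 scale1r.
    rewrite iterS ih (linear_onZ (@subspaceT X) (@sub_scalar_linear setT)) //.
    by rewrite Af ?wE ?scalerA -?exprSr //; lra.
  exists (w ^- n *: f (lambda + w)) => //.
  rewrite (linear_onZ (@subspaceT X) (@iter_linearT n)) // it scalerA mulVf ?scale1r //.
  by rewrite expf_neq0.
have itc m k : iter m A (c (m + k)%N) = c k.
  by elim: m k => [|m ih] k //; rewrite iterS addSnnS ih AS.
have c0 k : c k = 0.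
  (* The vector [c (p + m)] is killed by A^(p+1), hence by A^p, which sends it to [c m]. *)
  have Ac m : A (c m) = 0 -> c m = 0.
    move=> Am; have : ker (iter p.+1 A) (ran (iter n A) setT) (c (p + m)%N).
      by split; rewrite ?iterS ?itc.
    by rewrite -hp => -[_]; rewrite itc.
  by elim: k => [|k ih]; apply: Ac; rewrite ?AS.
exists s => // z za; have /= := cf _ za; rewrite (addrC lambda) subrK => h.
apply: tends_unique h _; apply: tends_eq (tends_cst _) => m.
by rewrite /psum big1 // => i _; rewrite c0 scaler0.
Qed.

End LocalSVEP.

(** * Analyticity of a power series *)

Section Reexpansion.
Context {R : realType} {X : completeNormedModType (Cplx R)}.
Local Notation C := (Cplx R).

(** A summation bound independent of the exponent allows sums over exponents and binomial indices to
    be exchanged. *)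
Lemma exprDn_nat (S : comPzRingType) (x y : S) n N : (n < N)%N ->
  (x + y) ^+ n = \sum_(0 <= i < N) (x ^+ (n - i) * y ^+ i) *+ 'C(n, i).
Proof.
move=> nN; rewrite exprDn (big_cat_nat (leq0n n.+1) nN) /= big_mkord.
rewrite [X in _ = _ + X]big_nat_cond [X in _ = _ + X]big1 ?addr0 // => i.
by rewrite andbT => /andP[ni _]; rewrite bin_small // mulr0n.
Qed.

Lemma rnMn (a : C) n : rn (a *+ n) <= rn a *+ n.
Proof.
elim: n => [|n ih]; first by rewrite !mulr0n rn0.
by rewrite !mulrS; apply: le_trans (rnD _ _) _; rewrite lerD2l.
Qed.

Lemma tends_sum (U : normedModType C) (u : nat -> nat -> U) (l : nat -> U) J :
  (forall j, tends (u j) (l j)) ->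
  tends (fun n => \sum_(0 <= j < J) u j n) (\sum_(0 <= j < J) l j).
Proof.
move=> ul; elim: J => [|J ih].
  by rewrite big_nil; apply: tends_eq (tends_cst _) => n; rewrite big_nil.
rewrite big_nat_recr //=; apply: tends_eq (tendsD ih (ul J)) => n.
by rewrite big_nat_recr.
Qed.

Definition taylor_remainder (w h : C) J k : C :=
  (w + h) ^+ k - \sum_(0 <= j < J) (w ^+ (k - j) * h ^+ j) *+ 'C(k, j).

(* The binomial terms of index j >= J are dominated by 2 ^ (j - J) times
   themselves. *)
Lemma taylor_remainder_le w h J k :
  rn (taylor_remainder w h J k) <= 2^-1 ^+ J * (rn w + 2 * rn h) ^+ k.
Proof.
pose N := (J + k).+1.
have JN : (J <= N)%N by rewrite /N -addnS leq_addr.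
have kN : (k < N)%N by rewrite /N ltnS leq_addl.
rewrite /taylor_remainder (exprDn_nat _ _ kN) (big_cat_nat (leq0n J) JN) /=.
rewrite addrAC subrr add0r (exprDn_nat _ _ kN) (big_cat_nat (leq0n J) JN) /= mulrDr.
rewrite -[leLHS]add0r; apply: lerD.
  rewrite mulr_ge0 ?exprn_ge0 ?invr_ge0 // sumr_ge0 // => i _.
  by rewrite mulrn_wge0 // mulr_ge0 // exprn_ge0 ?mulr_ge0 // rn_ge0.
apply: le_trans (rn_sum _ _) _; rewrite mulr_sumr !big_nat; apply: ler_sum => j.
move=> /andP[Jj _]; apply: le_trans (rnMn _ _) _.
rewrite mulrnAr lerMn2r; apply/orP; right.
rewrite rnM !rnX exprMn.
have w0 : 0 <= rn w ^+ (k - j) by rewrite exprn_ge0 // rn_ge0.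
have h0 : 0 <= rn h ^+ j by rewrite exprn_ge0 // rn_ge0.
have p0 := mulr_ge0 w0 h0.
have -> : 2^-1 ^+ J * (rn w ^+ (k - j) * (2 ^+ j * rn h ^+ j)) =
    (2^-1 ^+ J * 2 ^+ j) * (rn w ^+ (k - j) * rn h ^+ j) by ring.
rewrite -[leLHS]mul1r; apply: ler_wpM2r => //.
by rewrite exprVn mulrC ler_pdivlMr ?exprn_gt0 // mul1r ler_weXn2l // ler1n.
Qed.

(** Analyticity demands an expansion at every point of the disc, not only at [z0]. At offset [w] its
    coefficients are the binomial sums of C(i,j) w^(i-j) x_i, and the Taylor remainders make the
    error decay like 2^(-J). *)
Lemma series_analytic (x : nat -> X) (k b : R) (z0 : C) :
  0 <= k -> 0 < b -> (forall i, rn (x i) <= k * b ^+ i) ->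
  exists2 r : R, 0 < r & exists2 f : C -> X,
    analytic_on (ball z0 (rc r)) f & psconv x (fun w => f (z0 + w)) r.
Proof.
move=> k0 b0 xk.
(* Scalars of growth rate [t] with [t * b <= 1/2] yield terms dominated by a geometric series of
   ratio 1/2; all convergence below reduces to this. *)
have majo (v : nat -> C) (l t : R) : 0 <= l -> 0 <= t -> t * b <= 2^-1 ->
    (forall i, rn (v i) <= l * t ^+ i) ->
    forall i, rn (v i *: x i) <= l * k * 2^-1 ^+ i.
  move=> l0 t0 tb vt i; rewrite rnZ.
  apply: (@le_trans _ _ (l * t ^+ i * (k * b ^+ i))).
    by apply: ler_pM => //; apply: rn_ge0.
  have -> : l * t ^+ i * (k * b ^+ i) = l * k * (t * b) ^+ i by rewrite exprMn; ring.
  apply: ler_wpM2l; first exact: mulr_ge0.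
  by rewrite lerXn2r // nnegrE ?invr_ge0 // mulr_ge0 // ltW.
have majo_lim (v : nat -> C) (l t : R) : 0 <= l -> 0 <= t -> t * b <= 2^-1 ->
    (forall i, rn (v i) <= l * t ^+ i) ->
    exists y, tends (fun n => \sum_(0 <= i < n) v i *: x i) y.
  move=> l0 t0 tb vt; have lk0 := mulr_ge0 l0 k0.
  have h := half_cauchy lk0 (majo v l t l0 t0 tb vt).
  by have [y _ hy] := closed_complete (@closedT X) (fun _ => I) h; exists y.
have /choice[g hg] : forall w : C, exists y, rn w * b <= 2^-1 -> tends (psum x w) y.
  move=> w; have [wr|wr] := pselect (rn w * b <= 2^-1); last by exists 0.
  have [|||y hy] := majo_lim (fun i => w ^+ i) 1 (rn w) _ _ wr; [| | |by exists y] => //.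
  - exact: rn_ge0.
  - by move=> i; rewrite rnX mul1r.
(* With this radius and [s] equal to 1/(16 b) below, both [rn w + s] and [rn w + 2 * rn h] have
   product with [b] at most 1/2. *)
pose r := (4 * b)^-1; have r0 : 0 < r by rewrite invr_gt0 mulr_gt0.
have rb (w : C) : rn w < r -> rn w * b < 4^-1.
  by rewrite /r invfM ltr_pdivlMr.
exists r => //; exists (fun z => g (z - z0)) => [a|w wr]; last first.
  by rewrite addrAC subrr add0r; apply: hg; have := rb _ wr; lra.
move=> /ballrcP; set w := a - z0 => /rb bw.
pose s := (16 * b)^-1; have s0 : 0 < s by rewrite invr_gt0 mulr_gt0.
have bs : s * b = 16^-1 by rewrite /s; field; rewrite gt_eqF.
have rw0 := rn_ge0 w.
have /choice[c hc] : forall j : nat, exists y,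
    tends (fun n => \sum_(0 <= i < n) (w ^+ (i - j) *+ 'C(i, j)) *: x i) y.
  move=> j; apply: (majo_lim _ (s ^- j) (rn w + s)); [| |by nra|].
  - by rewrite invr_ge0 exprn_ge0 // ltW.
  - by rewrite addr_ge0 // ltW.
  - move=> i; rewrite ler_pdivlMl ?exprn_gt0 //.
    (* The quantity is one term of the binomial expansion of (rn w + s)^i, all of whose terms are
       nonnegative. *)
    apply: le_trans (_ : (rn w ^+ (i - j) * s ^+ j) *+ 'C(i, j) <= _).
      rewrite mulrC -mulrnAl ler_pM2r ?exprn_gt0 //.
      by apply: le_trans (rnMn _ _) _; rewrite rnX.
    have term0 m : 0 <= (rn w ^+ (i - m) * s ^+ m) *+ 'C(i, m).
      by rewrite mulrn_wge0 // mulr_ge0 // exprn_ge0 // ltW.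
    have ijN : (i < (i + j).+1)%N by rewrite ltnS leq_addr.
    rewrite (exprDn_nat _ _ ijN) big_mkord.
    have jN : (j < (i + j).+1)%N by rewrite ltnS leq_addl.
    rewrite (bigD1 (Ordinal jN)) //= lerDl; apply: sumr_ge0 => m _; exact: term0.
exists (rc (s)), c; split; first by rewrite rc_gt0.
move=> z /ballrcP; set h := z - a => hs; apply/tendsP.
have rh0 := rn_ge0 h.
have zwh : z - z0 = w + h by rewrite /w /h [RHS]addrC addrA subrK.
have hb : rn h * b < 16^-1 by rewrite -bs ltr_pM2r.
have whb : rn (w + h) * b <= 2^-1.
  have : rn (w + h) * b <= rn w * b + rn h * b by rewrite -mulrDl ler_wpM2r ?rnD // ltW.
  lra.
have k20 : 0 <= 2 * k by rewrite mulr_ge0.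
(* For fixed [J] the error is a limit of finite sums, where exchanging summations turns it into
   minus a sum of Taylor remainders. *)
have gap J : rn (psum c h J - g (z - z0)) <= 2 * k * 2^-1 ^+ J.
  have lim : tends (fun n =>
      psum (fun j => \sum_(0 <= i < n) (w ^+ (i - j) *+ 'C(i, j)) *: x i) h J
      - psum x (w + h) n) (psum c h J - g (z - z0)).
    rewrite zwh -[- g _]scaleN1r; apply: tendsD.
      by apply: tends_sum => j; apply: tendsZ.
    apply: tends_eq (tendsZ (-1) (hg _ whb)) => n.
    by rewrite scaleN1r.
  apply: (tends_le (N := 0%N) lim) => n _.
  have -> :
      psum (fun j => \sum_(0 <= i < n) (w ^+ (i - j) *+ 'C(i, j)) *: x i) h J
      - psum x (w + h) n = - \sum_(0 <= i < n) taylor_remainder w h J i *: x i.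
    rewrite /psum -[LHS]opprB; congr (- _).
    under [X in _ - X]eq_bigr => j _ do rewrite scaler_sumr.
    rewrite exchange_big /= -sumrB; apply: eq_bigr => i _.
    rewrite /taylor_remainder scalerBl scaler_suml; congr (_ - _).
    apply: eq_bigr => j _; rewrite scalerA; congr (_ *: _).
    by rewrite mulrnAr mulrC.
  rewrite rnN.
  have t0 : 0 <= rn w + 2 * rn h by rewrite addr_ge0 // mulr_ge0.
  have tb : (rn w + 2 * rn h) * b <= 2^-1 by rewrite mulrDl -mulrA; lra.
  have J0 : 0 <= 2^-1 ^+ J :> R by rewrite exprn_ge0 // invr_ge0.
  have term := majo _ _ _ J0 t0 tb (taylor_remainder_le w h J).
  have := half_tail (leq0n n) (mulr_ge0 J0 k0) (fun i _ => term i).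
  by rewrite expr0 mulr1 (mulrC (_ ^+ J)) mulrA.
move=> e e0; have [N hN] := half_lt k20 e0; exists N => n Nn.
by apply: le_lt_trans (gap n) (le_lt_trans _ hN); apply: half_le.
Qed.

End Reexpansion.

(** * Kato operators with SVEP *)

Section KatoSVEP.
Context {R : realType} {X : completeNormedModType (Cplx R)}.
Local Notation C := (Cplx R).
Context (T : {linear X -> X}).
Context (cT : continuous T).
Context (lambda : C) (M : set X).
Let A := sub_scalar T lambda.
Context (sM : subspace_set M) (cM : closed M) (MA : forall x, M x -> M (A x)).

Lemma sub_scalar_shift mu x : sub_scalar T mu x = A x + (lambda - mu) *: x.
Proof. by rewrite /A /sub_scalar scalerBl addrA subrK. Qed.

Lemma closed_range_lift : closed (ran A M) -> exists2 k : R, 0 < k &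
  forall x, M x -> exists z, [/\ M z, A z = A x & rn z <= k * rn (A x)].
Proof.
move=> cAM; have [b b0 hb] := sub_scalar_bounded cT lambda.
apply: (open_mapping (b := b)) => //.
- exact: sub_scalar_linear.
- exact: closed_complete.
- exact: closed_complete.
Qed.

Lemma iter_invariant n x : M x -> M (iter n A x).
Proof. by move=> Mx; elim: n => [|n ih] //; rewrite iterS; apply: MA. Qed.

Lemma Kato_SVEP_injective : Kato A M -> SVEP T lambda ->
  forall x, M x -> A x = 0 -> x = 0.
Proof.
move=> [cAM kerA] svep x0 Mx0 Ax0.
have lA : linear_on M A by apply: sub_scalar_linear.
have [k k0 lift] := closed_range_lift cAM.
(* The hyperrange of [A] on [M]; the Kato property puts [ker A M] inside it and makes every element
   of it the image of another, with norm control. *)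
pose H x := forall n, ran (iter n A) M x.
have step x : exists z, H x -> [/\ H z, A z = x & rn z <= k * rn x].
  have [Hx|nHx] := pselect (H x); last by exists 0.
  have [u Mu ux] := Hx 1%N; have [z [Mz zu zk]] := lift u Mu.
  exists z => _; rewrite zu; split=> //; last by rewrite -ux.
  move=> n; have [v Mv vx] := Hx n.+1.
  have Mnv := iter_invariant n Mv.
  (* Two preimages of [x] differ by a kernel vector, which lies in the range of A^n; hence so does
     [z]. *)
  have [|y My yz] := kerA n (z - iter n A v).
    split; first exact: subspaceB.
    rewrite (linear_onB sM lA) // zu; apply/eqP.
    by rewrite subr_eq0 -[A (iter n A v)]iterS vx -ux.
  exists (y + v); first exact: subspaceD.
  have lAn : linear_on M (iter n A) by apply: iter_linear.
  by rewrite (linear_onD lAn) // yz subrK.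
have /choice[g hg] := step.
pose x_ n := iter n g x0.
have Hx n : H (x_ n).
  elim: n => [|n ih]; first by move=> n; apply: kerA.
  by have [] := hg _ ih.
have Ax n : A (x_ n.+1) = x_ n by have [] := hg _ (Hx n).
have xk n : rn (x_ n) <= rn x0 * k ^+ n.
  elim: n => [|n ih]; first by rewrite expr0 mulr1.
  have [_ _ h] := hg _ (Hx n); apply: le_trans h _.
  by rewrite exprS mulrCA ler_wpM2l // ltW.
have [r r0 [f anf xf]] := series_analytic lambda (rn_ge0 x0) k0 xk.
have [b b0 hb] := sub_scalar_bounded cT lambda.
have := svep (rc r) _ f anf; rewrite rc_gt0 => /(_ r0) fz.
have f0 : f (lambda + 0) = x0 by apply: (psconv0 r0 xf).
rewrite -f0; apply: fz; last first.
  by apply/ballrcP; rewrite addr0 subrr rn0.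
move=> z /ballrcP zr; rewrite sub_scalar_shift.
have {1}-> : z = lambda + (z - lambda) by rewrite addrC subrK.
have {3}-> : z = lambda + (z - lambda) by rewrite addrC subrK.
set w := z - lambda; have -> : lambda - z = - w by rewrite opprB.
apply/eqP; rewrite scaleNr subr_eq0; apply/eqP.
have := psconv_map (M := setT) (b := b) (@subspaceT _ X)
    (@sub_scalar_linear _ _ T lambda setT) (fun x _ => hb x) (fun _ => I) (fun _ _ => I) xf zr.
(* The leading term [A x0] vanishes, and shifting the index identifies the series of A f with [w]
   times that of f. *)
move=> /tendsS h1; apply: (tends_unique h1).
apply: tends_eq (tendsZ w (xf w zr)) => n.
rewrite -/A big_nat_recl //= Ax0 scaler0 add0r /psum scaler_sumr.
by apply: eq_bigr => i _; rewrite -/(x_ i.+1) Ax scalerA exprS.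
Qed.

(** Injectivity forces the controlled preimage of [A x] to be [x], so [A] is bounded below with
    constant [k]; a perturbation of size at most 1/(2k) costs a factor 2. *)
Lemma Kato_SVEP_bounded_below : Kato A M -> SVEP T lambda ->
  exists2 k : R, 0 < k & forall mu x, rn (mu - lambda) * k <= 2^-1 -> M x ->
    rn x <= 2 * k * rn (sub_scalar T mu x).
Proof.
move=> kA svep; have [k k0 lift] := closed_range_lift kA.1.
have inj := Kato_SVEP_injective kA svep.
have lA : linear_on M A by apply: sub_scalar_linear.
exists k => // mu x muk Mx.
have {}lift : rn x <= k * rn (A x).
  have [z [Mz zx zk]] := lift x Mx.
  suff zE : z = x by rewrite -{1}zE.
  apply/eqP; rewrite -subr_eq0; apply/eqP/inj; first exact: subspaceB.
  by rewrite (linear_onB sM lA) // zx subrr.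
have Amu : A x = sub_scalar T mu x + (mu - lambda) *: x.
  by rewrite sub_scalar_shift -addrA -scalerDl subrKA subrr scale0r addr0.
have : k * rn (A x) <= k * rn (sub_scalar T mu x) + k * (rn (mu - lambda) * rn x).
  rewrite -mulrDr; apply: ler_wpM2l; first exact: ltW.
  by rewrite -rnZ {1}Amu; apply: rnD.
have : k * (rn (mu - lambda) * rn x) <= 2^-1 * rn x.
  by rewrite mulrA (mulrC k) ler_wpM2r // rn_ge0.
lra.
Qed.

End KatoSVEP.

(** * Meromorphic operators *)

Section Meromorphic.
Context {R : realType} {X : completeNormedModType (Cplx R)}.
Local Notation C := (Cplx R).
Context (T : {linear X -> X}).
Context (cT : continuous T).
Context (lambda0 : C) (N : set X).
Let S := scalar_sub lambda0 T.
Context (sN : subspace_set N) (NT : forall x, N x -> N (T x)).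

Lemma sub_scalar_invariant mu x : N x -> N (sub_scalar T mu x).
Proof. by move=> Nx; apply: subspaceB (NT Nx) _ => //; apply: subspaceZ. Qed.

(** Translates the spectral parameter [z] of [lambda0 - T] into the point [lambda0 - z] for [T]. *)
Lemma resolvent_arg z y : z *: y - S y = sub_scalar T (lambda0 - z) y.
Proof. by rewrite /S /scalar_sub /sub_scalar opprB scalerBl opprB addrCA. Qed.

Lemma bounded_operator_rn B : bounded_operator_on N B ->
  exists b : R, forall x, N x -> rn (B x) <= b * rn x.
Proof.
move=> [_ _ [c hc]]; exists (complex.Re c) => x /hc.
rewrite !rnE lecE => /andP[_]; rewrite /rc /=; case: c {hc} => c1 c2 /=.
by rewrite mulr0 subr0.
Qed.

(* A Drazin inverse without the condition D A D = D. *)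
Definition drazin_on (A D : X -> X) q :=
  [/\ bounded_operator_on N D,
      forall x, N x -> A (D x) = D (A x)
    & forall x, N x -> iter q.+1 A (D x) = iter q A x].

Lemma resolvent_drazin z B : is_resolvent S N z B ->
  drazin_on (sub_scalar T (lambda0 - z)) B 0.
Proof.
move=> [bB hl hr]; split=> // x Nx /=; last by rewrite -resolvent_arg hl.
by rewrite -!resolvent_arg hl // hr.
Qed.

(** Multiplied by w^q, with [q] the order of the pole, the resolvent becomes a power series with
    coefficients [P k]. Comparing coefficients in (A + w) G(w) = w^q shows that the constant term
    [P q] of the regular part is the required operator. *)
Lemma pole_drazin mu : is_resolvent_pole S N mu ->
  exists q D, drazin_on (sub_scalar T (lambda0 - mu)) D q.
Proof.
move=> [n [_ [P [/gt0_rc[r r0 ->] bP _ hP]]]].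
set A := sub_scalar T (lambda0 - mu); pose q := n.+1.
have NP k x : N x -> N (P k x) by have [h _ _] := bP k; apply: h.
have lP k : linear_on N (P k) by have [_ h _] := bP k.
have NA x : N x -> N (A x) by apply: sub_scalar_invariant.
have lA M : linear_on M A by apply: sub_scalar_linear.
have argE w y : (mu + w) *: y - S y = A y + w *: y.
  rewrite resolvent_arg (sub_scalar_shift T (lambda0 - mu)); congr (_ + _ *: _).
  by ring.
have /choice[B hB] : forall w : C, exists B, w <> 0 -> rn w < r ->
    [/\ is_resolvent S N (mu + w) B,
        linear_on N B
      & forall x, N x -> tends (psum (P^~ x) w) (w ^+ q *: B x)].
  move=> w; have [[w0 wr]|nw] := pselect (w <> 0 /\ rn w < r); last first.
    by exists id => ? ?; case: nw.
  have [||B [rB cB]] := hP (mu + w).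
  - by apply/ballrcP; rewrite addrAC subrr add0r.
  - by move/eqP; rewrite -subr_eq0 addrAC subrr add0r => /eqP.
  exists B => _ _; split=> //; first by have [[]] := rB.
  move=> x Nx.
  have wq : w ^+ q != 0 by rewrite expf_neq0 //; apply/eqP.
  have lim : tends (fun m => \sum_(0 <= k < m) (w ^+ k / w ^+ q) *: P k x) (B x).
    move=> e e0; have x0 := rn_ge0 x.
    have e10 : 0 < e / (rn x + 1) by rewrite divr_gt0 //; lra.
    have [|m0 _ hm] := cB (rc (e / (rn x + 1))); first by rewrite rc_gt0.
    exists m0 => m /hm /(_ x Nx); rewrite addrAC subrr add0r !rnE -rcM rc_le.
    move/le_lt_trans; apply; rewrite -mulrAC ltr_pdivrMr; last by lra.
    by rewrite ltr_pM2l //; lra.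
  apply: tends_eq (tendsZ (w ^+ q) lim) => m.
  rewrite scaler_sumr; apply: eq_bigr => k _.
  by rewrite scalerA mulrC divfK.
pose G x w := if w == 0 then P 0%N x else w ^+ q *: B w x.
have psG x : N x -> psconv (P^~ x) (G x) r.
  move=> Nx w wr; rewrite /G; have [->|/eqP w0] := eqVneq w 0.
    by apply: tends_Sr; apply: tends_eq (tends_cst _) => m; rewrite psum0.
  by have [_ _ h] := hB w w0 wr; apply: h.
have NG x w : N x -> rn w < r -> N (G x w).
  move=> Nx wr; rewrite /G; have [_|/eqP w0] := eqVneq w 0; first exact: NP.
  by have [[[NB _ _] _ _] _ _] := hB w w0 wr; apply: subspaceZ => //; apply: NB.
have [b b0 hb] := sub_scalar_bounded cT (lambda0 - mu).
pose sh (x : X) k := if k is k'.+1 then P k' x else 0.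
have small (e : R) : 0 < e -> exists w : C, [/\ w <> 0, rn w < e & rn w < r].
  move=> e0; pose m := Num.min e r.
  have m0 : 0 < m by rewrite lt_min e0.
  have me : m <= e by rewrite ge_min lexx.
  have mr : m <= r by rewrite ge_min lexx orbT.
  have rm : rn (rc (m / 2)) = m / 2 by apply: rn_rc; lra.
  exists (rc (m / 2)); rewrite rm; split; [|lra|lra].
  by move/(congr1 rn); rewrite rm rn0; lra.
have psN (x : X) : psconv (fun k => if k == q then - x else 0) (fun w => - (w ^+ q *: x)) r.
  move=> w wr; rewrite -scalerN; exact: (psconv_monom q (- x) wr).
(* Coefficient of w^k in (A + w) G(w) x = w^q x; the counterpart [right] has [A] applied first, and
   together they give commutation. *)
have left x k : N x -> A (P k x) + sh x k + (if k == q then - x else 0) = 0.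
  move=> Nx; have psA : psconv (fun k => A (P k x)) (fun w => A (G x w)) r.
    by apply: (psconv_map sN (lA N) (fun x _ => hb x)) => [j|w|];
      [exact: NP|exact: NG|exact: psG].
  apply: (@psconv_eq0 _ _ (fun k => A (P k x) + sh x k + (if k == q then - x else 0))
    _ _ r0 (psconvD (psconvD psA (psconvX (psG x Nx))) (psN x)) _ k).
  move=> e /small[w [w0 we wr]]; exists w; split=> //.
  rewrite /= /G; move/eqP: (w0) => /negbTE ->.
  have [[_ hl _] _ _] := hB w w0 wr; have := hl x Nx; rewrite argE => e2.
  have -> : w ^+ q *: x = w ^+ q *: (A (B w x) + w *: B w x) by rewrite e2.
  rewrite (linear_onZ (subspaceT X) (lA setT)) //.
  rewrite (scalerDr _ (A (B w x))) scalerA mulrC -scalerA.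
  by rewrite subrr.
have right x k : N x -> P k (A x) + sh x k + (if k == q then - x else 0) = 0.
  move=> Nx; have NAx := NA x Nx.
  apply: (@psconv_eq0 _ _ (fun k => P k (A x) + sh x k + (if k == q then - x else 0))
    _ _ r0 (psconvD (psconvD (psG _ NAx) (psconvX (psG x Nx))) (psN x)) _ k).
  move=> e /small[w [w0 we wr]]; exists w; split=> //.
  rewrite /= /G; move/eqP: (w0) => /negbTE ->.
  have [[_ _ hr] lB _] := hB w w0 wr; have := hr x Nx; rewrite argE => e2.
  have -> : w ^+ q *: x = w ^+ q *: (w *: B w x + B w (A x)).
    by rewrite -lB // (addrC (w *: x)) e2.
  by rewrite addrC scalerDr scalerA mulrC -scalerA (addrC (w *: (w ^+ q *: B w x))) addNr.
have comm x k : N x -> A (P k x) = P k (A x).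
  move=> Nx; apply: (addIr (sh x k)); apply: (addIr (if k == q then - x else 0)).
  by rewrite left // right.
(* Below index [q] the relation reads A P_j = - P_(j-1), starting from A P_0 = 0, so powers of [A]
   kill the principal part. *)
have nil j x : (j < q)%N -> N x -> iter j.+1 A (P j x) = 0.
  elim: j => [|j ih] jq Nx.
    by have := left x 0%N Nx; rewrite /= !addr0.
  have /= := left x j.+1 Nx; rewrite (ltn_eqF jq) addr0 => /eqP.
  rewrite addr_eq0 => /eqP AP; rewrite -!iterS iterSr AP.
  rewrite (linear_onN (subspaceT X) (@iter_linearT _ _ T _ j.+1)) //.
  by rewrite ih ?oppr0 // ltnW.
exists q, (P q); split => //; first by move=> x Nx; apply: comm.
move=> x Nx; have /= := left x q Nx; rewrite eqxx => /eqP; rewrite -addrA addr_eq0 => /eqP AP.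
rewrite -!iterS iterSr AP opprD opprK addrC.
rewrite (linear_onB (subspaceT X) (@iter_linearT _ _ T _ q)) //.
by rewrite nil // subr0.
Qed.

Lemma meromorphic_drazin z : meromorphic S N -> z <> 0 ->
  exists q D, drazin_on (sub_scalar T (lambda0 - z)) D q.
Proof.
move=> mer z0; have [zs|/contrapT[B rB]] := pselect (spectrum S N z).
  exact/pole_drazin/mer.
by exists 0%N, B; apply: resolvent_drazin.
Qed.

(** A nonzero spectral point is a pole, hence isolated in the spectrum: if [e / 2] is spectral, a
    slightly larger real number is not. *)
Lemma meromorphic_resolvent_dense (e : R) : meromorphic S N -> 0 < e ->
  exists z B, rn z < e /\ is_resolvent S N z B.
Proof.
move=> mer e0; pose z1 : C := rc (e / 2).
have z1e : rn z1 = e / 2 by rewrite rn_rc // divr_ge0 // ltW.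
have [zs|/contrapT[B rB]] := pselect (spectrum S N z1); last first.
  by exists z1, B; split => //; rewrite z1e; lra.
have [|n [_ [P [/gt0_rc[r r0 ->] _ _ hP]]]] := mer z1 zs.
  by move/(congr1 rn); rewrite z1e rn0; lra.
pose m := Num.min e r / 4.
have m0 : 0 < m by rewrite divr_gt0 // lt_min e0.
have rm : rn (rc m) = m by rewrite rn_rc // ltW.
have me : m <= e / 4 by rewrite ler_pM2r ?invr_gt0 // ge_min lexx.
have mr : m <= r / 4 by rewrite ler_pM2r ?invr_gt0 // ge_min lexx orbT.
have [||B [rB _]] := hP (z1 + rc m).
- by apply/ballrcP; rewrite addrAC subrr add0r rm; lra.
- by move/eqP; rewrite -subr_eq0 addrAC subrr add0r => /eqP/(congr1 rn); rewrite rm rn0; lra.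
exists (z1 + rc m), B; split => //; apply: le_lt_trans (rnD _ _) _.
by rewrite z1e rm; lra.
Qed.

End Meromorphic.

(** * Direct sums *)

Section DirectSum.
Context {R : realType} {X : completeNormedModType (Cplx R)}.
Local Notation C := (Cplx R).

Lemma rn_pair (p : X * X) : rn p = Num.max (rn p.1) (rn p.2).
Proof.
rewrite {1}/rn prod_normE /Order.max !rnE rc_lt.
by case: ifP.
Qed.

(** Boundedness of the two projections: the open mapping theorem for addition on the product of [M]
    and [N], where uniqueness of the decomposition identifies the controlled pair with [(u, v)]. *)
Lemma direct_sum_bound (M N : set X) :
  closed_subspace M -> closed_subspace N ->
  (forall x, exists u v, [/\ M u, N v & x = u + v]) -> M `&` N = [set 0] ->
  exists2 k : R, 0 < k & forall u v, M u -> N v ->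
    rn u <= k * rn (u + v) /\ rn v <= k * rn (u + v).
Proof.
move=> [sM cM] [sN cN] MN MN0.
pose MxN : set (X * X) := [set p | M p.1 /\ N p.2].
pose add (p : X * X) : X := p.1 + p.2.
have sMN : subspace_set MxN.
  split; first by split; [case: sM|case: sN].
  by move=> a x y [? ?] [? ?]; split; [apply: sM.2|apply: sN.2].
have ladd : linear_on MxN add.
  by move=> a x y _ _; rewrite /add /= scalerDr addrACA.
have badd p : MxN p -> rn (add p) <= 2 * rn p.
  move=> _; apply: le_trans (rnD _ _) _; rewrite rn_pair.
  have : rn p.1 <= Num.max (rn p.1) (rn p.2) by rewrite le_max lexx.
  have : rn p.2 <= Num.max (rn p.1) (rn p.2) by rewrite le_max lexx orbT.
  lra.
have cMN : complete_set MxN.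
  move=> u Mu cu.
  have [||l1 Ml1 ul1] := closed_complete cM (u := fun n => (u n).1).
  - by move=> n; have [] := Mu n.
  - move=> e /cu[n0 h]; exists n0 => n m hn hm; apply: le_lt_trans (h n m hn hm).
    by rewrite rn_pair le_max lexx.
  have [||l2 Nl2 ul2] := closed_complete cN (u := fun n => (u n).2).
  - by move=> n; have [] := Mu n.
  - move=> e /cu[n0 h]; exists n0 => n m hn hm; apply: le_lt_trans (h n m hn hm).
    by rewrite rn_pair le_max lexx orbT.
  exists (l1, l2) => // e e0; have [[n1 h1] [n2 h2]] := (ul1 e e0, ul2 e e0).
  exists (maxn n1 n2) => n; rewrite geq_max => /andP[/h1 ? /h2 ?].
  by rewrite rn_pair gt_max; apply/andP.
have caMN : complete_set (add @` MxN).
  move=> u _ /(closed_complete (@closedT X) (fun _ => I))[l _ ul].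
  by exists l => //; have [a [b [Ma Nb ->]]] := MN l; exists (a, b).
have [k k0 hk] := open_mapping sMN ladd badd cMN caMN.
exists k => // u v Mu Nv; have [|[u' v'] [[/= Mu' Nv'] e kuv]] := hk (u, v) _ => //.
have d : u' - u = v - v'.
  by apply/eqP; rewrite subr_eq addrAC eq_sym subr_eq addrC eq_sym; apply/eqP.
have : (M `&` N) (u' - u).
  by split; [exact: subspaceB|rewrite d; exact: subspaceB].
rewrite MN0 => d0; move: d; rewrite d0 => /esym/eqP; rewrite subr_eq0 => /eqP vE.
move/eqP: d0; rewrite subr_eq0 => /eqP uE.
by move: kuv; rewrite rn_pair ge_max /= uE -vE => /andP.
Qed.

End DirectSum.

(** * Sums of a part bounded below and a part with a Drazin-type inverse *)

Section SemiBBrowder.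
Context {R : realType} {X : completeNormedModType (Cplx R)}.
Local Notation C := (Cplx R).
Context (T : {linear X -> X}).
Context (cT : continuous T).
Context (M N : set X) (lambda : C).
Let A := sub_scalar T lambda.
Context (sM : closed_subspace M) (sN : closed_subspace N).
Context (MA : forall x, M x -> M (A x)) (NA : forall x, N x -> N (A x)).
Context (MN : forall x, exists u v, [/\ M u, N v & x = u + v]).
Context (MN0 : M `&` N = [set 0]).
Context (k : R).
Context (k0 : 0 < k) (Ak : forall x, M x -> rn x <= k * rn (A x)).

Lemma iter_bounded_below n x : M x -> rn x <= k ^+ n * rn (iter n A x).
Proof.
move=> Mx; elim: n => [|n ih]; first by rewrite expr0 mul1r.
apply: le_trans ih _; rewrite exprSr -mulrA; apply: ler_wpM2l.
  by rewrite exprn_ge0 // ltW.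
by apply: Ak; apply: iter_invariant.
Qed.

(** On [N] the operator [D] is a left inverse of [A], so both parts are bounded below; the bounded
    projections combine the two estimates. *)
Lemma resolvent_bounded_below D : drazin_on N A D 0 -> bounded_below A.
Proof.
move=> [bD comm hD]; have [b hb] := bounded_operator_rn bD.
have [K K0 hK] := direct_sum_bound sM sN MN MN0.
pose c := K * (k + `|b|) + 1.
have kb0 : 0 <= k + `|b| by rewrite addr_ge0 // ltW.
have c0 : 0 < c by rewrite ltr_wpDl // mulr_ge0 // ltW.
exists (rc c^-1); split; first by rewrite rc_gt0 invr_gt0.
move=> x; rewrite !rnE -rcM rc_le ler_pdivrMl //.
have [u [v [Mu Nv ->]]] := MN x.
have lA : linear_on setT A by apply: sub_scalar_linear.
have [h1 h2] := hK _ _ (MA Mu) (NA Nv).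
rewrite (linear_onD lA) //; apply: le_trans (rnD _ _) _.
have h3 := Ak Mu; have h4 : rn v <= `|b| * rn (A v).
  have -> : rn v = rn (D (A v)) by rewrite -comm // -[A (D v)]/(iter 1 A (D v)) hD.
  apply: le_trans (hb _ (NA Nv)) _; apply: ler_wpM2r; [exact: rn_ge0|exact: ler_norm].
have h5 : k * rn (A u) <= k * (K * rn (A u + A v)) by rewrite ler_wpM2l // ltW.
have h6 : `|b| * rn (A v) <= `|b| * (K * rn (A u + A v)) by rewrite ler_wpM2l.
have := rn_ge0 (A u + A v); rewrite /c; lra.
Qed.

Section Drazin.
Context {D : X -> X}.

(** Lets the closed range result be applied to A^(q+1) as well. *)
Lemma drazin_onS q : drazin_on N A D q -> drazin_on N A D q.+1.
Proof. by move=> [bD comm hD]; split=> // x Nx; rewrite iterS hD. Qed.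

Context {q : nat}.
Context (hD : drazin_on N A D q).

Let ND x : N x -> N (D x). Proof. by have [[h _ _] _ _] := hD; apply: h. Qed.

Lemma drazin_comm j x : N x -> D (iter j A x) = iter j A (D x).
Proof.
have [_ comm _] := hD => Nx; elim: j => [//|j ih].
by rewrite !iterS -ih comm //; apply: iter_invariant.
Qed.

Lemma drazin_cancel j x : N x -> iter q A (iter j D (iter j A x)) = iter q A x.
Proof.
have [_ comm hq] := hD; elim: j x => [//|j ih] x Nx.
rewrite iterSr (iterSr j) drazin_comm; last exact: NA.
rewrite ih; last exact/ND/NA.
by rewrite -comm // -iterSr hq.
Qed.

(** The components of a convergent sequence in the range converge separately. On [M], the power A^q
    is bounded below, so preimages converge; on [N], the bounded operator A^q D^q fixes the range of
    A^q, hence also its limits. *)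
Lemma drazin_closed_range : closed (ran (iter q A) setT).
Proof.
have [bD comm hq] := hD.
have [K K0 hK] := direct_sum_bound sM sN MN MN0.
have lAq : linear_on setT (iter q A) by exact: iter_linearT.
apply: closed_tendsP => y l Yy yl.
have /choice[a ha] : forall n, exists ab : X * X,
    [/\ M ab.1, N ab.2 & y n = iter q A ab.1 + iter q A ab.2].
  move=> n; have [x _ <-] := Yy n; have [u [v [Mu Nv ->]]] := MN x.
  by exists (u, v); split => //; rewrite (linear_onD lAq).
have [l1 [l2 [Ml1 Nl2 lE]]] := MN l.
have Ma n : M (iter q A (a n).1) by apply: iter_invariant => //; have [] := ha n.
have Na n : N (iter q A (a n).2) by apply: iter_invariant => //; have [] := ha n.
have both n : rn (iter q A (a n).1 - l1) <= K * rn (y n - l) /\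
    rn (iter q A (a n).2 - l2) <= K * rn (y n - l).
  have [_ _ ->] := ha n; rewrite lE opprD addrACA.
  by apply: hK; apply: subspaceB => //; [case: sM|case: sN].
have scaled (z : nat -> X) m : (forall n, rn (z n - m) <= K * rn (y n - l)) -> tends z m.
  move=> hz e e0; have [|n0 hn0] := yl (e / K); first by rewrite divr_gt0.
  exists n0 => n /hn0; rewrite ltr_pdivlMr // mulrC; exact: le_lt_trans.
have t1 := scaled _ _ (fun n => (both n).1).
have t2 := scaled _ _ (fun n => (both n).2).
have [|e e0|u Mu tu] := closed_complete sM.2 (u := fun n => (a n).1).
- by move=> n; have [] := ha n.
- have e1 : 0 < e / (2 * k ^+ q) by rewrite divr_gt0 // mulr_gt0 // exprn_gt0.
  have [n0 hn0] := t1 _ e1; exists n0 => n m hn hm.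
  have Man : M ((a n).1 - (a m).1).
    by apply: subspaceB; [case: sM|have [] := ha n|have [] := ha m].
  apply: le_lt_trans (iter_bounded_below q Man) _.
  rewrite (linear_onB (subspaceT X) lAq) // -ltr_pdivlMl ?exprn_gt0 //.
  have := rn_triangle l1 (iter q A (a n).1) (iter q A (a m).1).
  have := hn0 _ hn; have := hn0 _ hm; rewrite (rnC l1).
  have -> : (k ^+ q)^-1 * e = e / (2 * k ^+ q) + e / (2 * k ^+ q).
    by field; rewrite expf_neq0 // gt_eqF.
  lra.
have l1E : l1 = iter q A u.
  apply: (tends_unique t1); have [b b0 hb] := iter_bounded cT lambda q.
  apply: (tends_lip (M := setT) (k := b)) tu => // x z _ _.
  by rewrite -(linear_onB (subspaceT X) lAq).
have l2E : l2 = iter q A (iter q D l2).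
  apply: (tends_unique t2); have [b b0 hb] := iter_bounded cT lambda q.
  have [d hd] := bounded_operator_rn bD.
  have NDj j x : N x -> N (iter j D x).
    by move=> Nx; elim: j => [|j ih] //; rewrite iterS; apply: ND.
  have lDj j : linear_on N (iter j D).
    have [_ lD _] := bD; elim: j => [|j ih] // c x z Nx Nz.
    by rewrite !iterS ih // lD //; apply: NDj.
  have bDj j x : N x -> rn (iter j D x) <= `|d| ^+ j * rn x.
    move=> Nx; elim: j => [|j ih]; first by rewrite expr0 mul1r.
    rewrite iterS exprS -mulrA; apply: le_trans (hd _ (NDj j _ Nx)) _.
    apply: (@le_trans _ _ (`|d| * rn (iter j D x))); last exact: ler_wpM2l.
    by apply: ler_wpM2r; [exact: rn_ge0|exact: ler_norm].
  apply: (tends_eq (u := fun n => iter q A (iter q D (iter q A (a n).2)))) => [n|].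
    by rewrite drazin_cancel //; have [] := ha n.
  apply: (tends_lip (M := N) (f := fun x => iter q A (iter q D x))
    (k := b * `|d| ^+ q)) t2 => // x z Nx Nz.
  rewrite -(linear_onB (subspaceT X) lAq) // -(linear_onB sN.1 (lDj q)) //.
  apply: le_trans (hb _) _; rewrite -mulrA; apply: ler_wpM2l => //.
  by apply: bDj; apply: subspaceB; [case: sN| |].
exists (u + iter q D l2) => //.
by rewrite (linear_onD lAq) // -l1E -l2E.
Qed.

(** Both components of a preimage are killed by A^(q+1). The one in [M] is then 0, and for the one
    in [N], A^q v = A^(q+1) D v = D A^(q+1) v = 0. *)
Lemma drazin_injective x : ran (iter q A) setT x -> A x = 0 -> x = 0.
Proof.
have [bD comm hq] := hD; move=> [w _ <-].
have [u [v [Mu Nv ->]]] := MN w.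
have lA j : linear_on setT (iter j A) by apply: iter_linearT.
rewrite -iterS (linear_onD (lA _)) // => h0.
have [K K0 hK] := direct_sum_bound sM sN MN MN0.
have [] := hK _ _ (iter_invariant MA q.+1 Mu) (iter_invariant NA q.+1 Nv).
rewrite h0 rn0 mulr0 => hu hv.
have Au : iter q.+1 A u = 0 by apply: rn_eq0; apply/eqP; rewrite eq_le hu rn_ge0.
have Av : iter q.+1 A v = 0 by apply: rn_eq0; apply/eqP; rewrite eq_le hv rn_ge0.
have -> : u = 0.
  have := iter_bounded_below q.+1 Mu; rewrite Au rn0 mulr0 => h.
  by apply: rn_eq0; apply/eqP; rewrite eq_le h rn_ge0.
rewrite add0r -hq // -drazin_comm // Av.
by have [_ lD _] := bD; apply: linear_on0 sN.1 lD.
Qed.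

End Drazin.

(** On the range of A^q the kernel is zero and the ascent is 0; the image of that range is the range
    of A^(q+1), closed by the same argument one power higher. *)
Lemma drazin_upper_semi_B_Browder D q : drazin_on N A D q -> upper_semi_B_Browder A.
Proof.
move=> hD; have inj := drazin_injective hD.
exists q; split; first exact: drazin_closed_range hD.
split; [split|exists 0%N].
- exists 0%N, (fun _ => 0); split=> [[]//|x [Yx Ax]].
  by exists (fun _ => 0); rewrite big_ord0; apply: inj.
- suff -> : ran A (ran (iter q A) setT) = ran (iter q.+1 A) setT.
    exact: drazin_closed_range (drazin_onS hD).
  rewrite /ran; apply/seteqP; split => x /=.
    by move=> [_ [w _ <-] <-]; exists w.
  by move=> [w _ <-]; exists (iter q A w) => //; exists w.
- apply/seteqP; split => x [Yx] /= Ax; split => //=; last exact: inj.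
  by rewrite Ax; apply: linear_on0 (subspaceT X) (@sub_scalar_linear _ _ T lambda setT).
Qed.

End SemiBBrowder.

(** * SVEP, approximate point spectrum and upper semi-B-Browder spectrum at [lambda0] *)

Unset Implicit Arguments.

Theorem corollary2p1 (R : realType) (X : completeNormedModType (Cplx R))
  (T : {linear X -> X}) (lambda0 : Cplx R)
  (hX : ~ finite_dim (setT : set X))
  (hT : continuous T)
  (hdec : generalized_Kato_meromorphic (scalar_sub lambda0 T)) :
  (SVEP T lambda0 <-> ~ interior (sigma_ap T) lambda0) /\
  (~ interior (sigma_ap T) lambda0 <-> ~ limit_point (sigma_BBplus T) lambda0).
Proof.
have [M [N [[[cM cN] SM SN MN MN0] kS mer]]] := hdec.
have scalarE x : sub_scalar T lambda0 x = - scalar_sub lambda0 T x.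
  by rewrite /sub_scalar /scalar_sub opprB.
have MT x : M x -> M (T x).
  move=> Mx; have -> : T x = lambda0 *: x - scalar_sub lambda0 T x.
    by rewrite /scalar_sub opprB addrC subrK.
  by apply: subspaceB (subspaceZ _ cM.1 Mx) (SM _ Mx); exact: cM.1.
have NT x : N x -> N (T x).
  move=> Nx; have -> : T x = lambda0 *: x - scalar_sub lambda0 T x.
    by rewrite /scalar_sub opprB addrC subrK.
  by apply: subspaceB (subspaceZ _ cN.1 Nx) (SN _ Nx); exact: cN.1.
have MA mu x : M x -> M (sub_scalar T mu x) by apply: sub_scalar_invariant cM.1 MT _ _.
have NA mu x : N x -> N (sub_scalar T mu x) by apply: sub_scalar_invariant cN.1 NT _ _.
(* The decomposition is given for [lambda0 - T]; the change of sign affects neither kernels nor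
   ranges of powers. *)
have kA : Kato (sub_scalar T lambda0) M.
  have AM n : linear_on M (iter n (sub_scalar T lambda0)) := iter_linear n (MA lambda0).
  have itS n x : M x ->
      iter n (scalar_sub lambda0 T) x = iter n (sub_scalar T lambda0) ((-1) ^+ n *: x).
    move=> Mx; elim: n => [|n ih]; first by rewrite expr0 scale1r.
    rewrite iterS -[LHS]opprK -scalarE ih -iterS.
    by rewrite exprS mulN1r scaleNr (linear_onN cM.1 (AM _)) //; apply: subspaceZ cM.1 Mx.
  have SN1 x : scalar_sub lambda0 T (- x) = - scalar_sub lambda0 T x.
    by rewrite /scalar_sub scalerN linearN opprB opprK addrC.
  split=> [|n x [Mx Ax]].
    suff -> : ran (sub_scalar T lambda0) M = ran (scalar_sub lambda0 T) M by exact: kS.1.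
    rewrite /ran; apply/seteqP; split=> _ [x Mx <-]; exists (- x); rewrite ?scalarE.
    - exact: subspaceN cM.1 Mx.
    - by rewrite SN1.
    - exact: subspaceN cM.1 Mx.
    - by rewrite SN1 opprK.
  have [|y My <-] := kS.2 n x; first by split=> //; rewrite -[LHS]opprK -scalarE Ax oppr0.
  by rewrite itS //; exists ((-1) ^+ n *: y) => //; apply: subspaceZ cM.1 My.
have svep_bound (svep : SVEP T lambda0) :=
  Kato_SVEP_bounded_below hT cM.1 cM.2 (MA lambda0) kA svep.
have i_ii : SVEP T lambda0 -> ~ interior (sigma_ap T) lambda0.
  move=> /svep_bound[k k0 hk] /nbhs_rnP[e e0 ap].
  (* Within [(2 * k)^-1] of [lambda0] the lower bound on [M] holds; a resolvent point of the [N]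
     part inside this radius supplies the other half. *)
  have m0 : 0 < Num.min e (2 * k)^-1 by rewrite lt_min e0 invr_gt0 mulr_gt0.
  have [z [B [ze rB]]] := meromorphic_resolvent_dense mer m0.
  move: ze; rewrite lt_min => /andP[ze zk].
  have zE : rn (lambda0 - z - lambda0) = rn z by rewrite addrAC subrr add0r rnN.
  apply: (ap (lambda0 - z)); first by rewrite zE.
  apply: (resolvent_bounded_below cM cN (MA _) (NA _) MN MN0 (k := 2 * k)).
  - by rewrite mulr_gt0.
  - move=> x; apply: hk; rewrite zE; move: zk.
    by rewrite invfM -ltr_pdivrMr ?invr_gt0 // invrK => /ltW.
  - exact: resolvent_drazin rB.
have i_iii : SVEP T lambda0 -> ~ limit_point (sigma_BBplus T) lambda0.
  move=> /svep_bound[k k0 hk] /(_ [set y | rn (y - lambda0) < (2 * k)^-1]) [|y [yl By yk]].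
    by apply/nbhs_rnP; exists (2 * k)^-1; rewrite ?invr_gt0 ?mulr_gt0.
  apply: By; have [|q [D hD]] := meromorphic_drazin hT cN.1 NT mer (z := lambda0 - y).
    by move/eqP; rewrite subr_eq0 => /eqP yE; rewrite yE eqxx in yl.
  move: hD; rewrite subKr => hD.
  apply: (drazin_upper_semi_B_Browder hT cM cN (MA y) (NA y) MN MN0 (k := 2 * k)) hD.
  - by rewrite mulr_gt0.
  - by move=> x; apply: hk; move: yk; rewrite /= invfM -ltr_pdivrMr ?invr_gt0 // invrK => /ltW.
(* Common to both converses: good points arbitrarily near [lambda0] make a solution locally zero
   there, and the identity theorem spreads this over the disc. *)
have svep_of : (forall r : R, 0 < r -> exists2 mu, rn (mu - lambda0) < r &
    exists n, closed (ran (iter n (sub_scalar T mu)) setT) /\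
      finite_ascent (sub_scalar T mu) (ran (iter n (sub_scalar T mu)) setT)) ->
    SVEP T lambda0.
  move=> h _ /gt0_rc[r r0 ->] f anf fz z /ballrcP zr.
  have [mu mur [n [cY fa]]] := h r r0.
  apply: (identity_theorem anf mur _ zr).
  apply: (finite_ascent_locally_zero hT anf mur _ cY fa) => y yr.
  exact/fz/ballrcP.
have ii_i : ~ interior (sigma_ap T) lambda0 -> SVEP T lambda0.
  move=> h; apply: svep_of => r r0; apply: contrapT => h'; apply: h.
  apply/nbhs_rnP; exists r => // mu mur bb; apply: h'; exists mu => //.
  (* With n = 0 the range is the whole space, and a bounded below operator is injective, so its
     ascent is 0. *)
  exists 0%N; split; first by apply/closed_rnP => x _; exists x.
  exists 0%N; apply/seteqP; split => x [Yx] /= Ax; split => //=.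
    by rewrite Ax /sub_scalar linear0 scaler0 subr0.
  have [c [c0 /(_ x)]] := bb; rewrite Ax normr0 pmulr_rle0 // normr_le0.
  by move/eqP.
have iii_i : ~ limit_point (sigma_BBplus T) lambda0 -> SVEP T lambda0.
  move=> h; apply: svep_of => r r0; apply: contrapT => h'; apply: h.
  (* The point [lambda0 + m] differs from [lambda0] and lies in both [U] and the disc of radius [r];
     were it outside the spectrum, it would be one of the good points assumed absent. *)
  move=> U /nbhs_rnP[e e0 Ue]; pose m := Num.min e r / 2.
  have er0 : 0 < Num.min e r by rewrite lt_min e0.
  have m0 : 0 < m by rewrite divr_gt0.
  have me : m < e.
    by apply: (@lt_le_trans _ _ (Num.min e r)); [rewrite /m; lra|rewrite ge_min lexx].
  have mr : m < r.
    by apply: (@lt_le_trans _ _ (Num.min e r)); [rewrite /m; lra|rewrite ge_min lexx orbT].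
  have dE : rn (lambda0 + rc m - lambda0) = m by rewrite addrAC subrr add0r rn_rc // ltW.
  exists (lambda0 + rc m); split; last by apply: Ue; rewrite dE.
    by rewrite -subr_eq0; apply/eqP => /(congr1 rn); rewrite dE rn0; lra.
  move=> [n [cY [_ fa]]]; apply: h'; exists (lambda0 + rc m); first by rewrite dE.
  by exists n.
by split; split; auto.
Qed.
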